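(* Suppose comparison holds for a subequation $F$ on a riemannian manifold $X$. Let $\Omega\subset\subset X$ be a domain with smooth boundary such that each of $F_{\rm strict}(\overline\Omega)$ and $\widetilde F_{\rm strict}(\overline\Omega)$ contains at least one function bounded below, and suppose $\partial\Omega$ is both strictly $F$-convex and strictly $\widetilde F$-convex. Then existence and uniqueness hold for the Dirichlet problem for $F$ on $\Omega$: for every $\varphi\in C(\partial\Omega)$ the Perron function $U$ satisfies $U\in C(\overline\Omega)$, $U$ is $F$-harmonic on $\Omega$, and $U=\varphi$ on $\partial\Omega$; and $U$ is the only function with these three properties.
   Context: **Subequations.** $J^2(X)\to X$ is the bundle of 2-jets of real functions, $J^2_xu$ the 2-jet of $u$ at $x$. $\mathrm{Sym}^2(T^*X)\subset J^2(X)$ is the subbundle of 2-jets at $x$ of functions with value $0$ and differential $0$ at $x$; $\mathcal P\subset \mathrm{Sym}^2(T^*X)$ is the set of nonnegative forms; $\mathcal N\subset J^2(X)$ is the set of 2-jets of constant functions with value $\le 0$. Sums of subsets are fibrewise. A *subequation* on $X$ is a subset $F\subset J^2(X)$ with (P) $F+\mathcal P\subset F$; (N) $F+\mathcal N\subset F$; (T) $F=\overline{\mathrm{Int}\,F}$, $F_x=\overline{\mathrm{Int}\,F_x}$ and $\mathrm{Int}\,F_x=(\mathrm{Int}\,F)_x$ for all $x$ ($F_x$ is the fibre and $\mathrm{Int}\,F_x$ its interior in $J^2_x(X)$). The *dual* is $\widetilde F=\{J: -J\notin \mathrm{Int}\,F\}$, again a subequation. **Subharmonic functions, comparison.** $\mathrm{USC}(Y)$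 is the set of upper semicontinuous functions $Y\to[-\infty,\infty)$. For $F\subset J^2(X)$ and open $Y\subset X$, $u\in F(Y)$ ($F$-subharmonic) means $u\in\mathrm{USC}(Y)$ and, for each $x\in Y$ and each $\varphi$ of class $C^2$ near $x$ with $u-\varphi\le0$ near $x$ and $=0$ at $x$, one has $J^2_x\varphi\in F_x$. $u$ is $F$-harmonic on $Y$ if $u\in F(Y)$ and $-u\in\widetilde F(Y)$. For compact $K$, $F(K)=\{u\in\mathrm{USC}(K):u|_{\mathrm{Int}K}\in F(\mathrm{Int}\,K)\}$. Comparison holds for $F$ on $X$ if for all compact $K\subset X$, $u\in F(K)$, $v\in\widetilde F(K)$: $u+v\le0$ on $\partial K$ implies $u+v\le0$ on $K$. Fix a metric on the vector bundle $J^2(X)$; for $c>0$, $F^c_x=\{J\in F_x:\mathrm{dist}(J,J^2_x(X)\setminus F_x)\ge c\}$. $u\in F_{\rm strict}(Y)$ if each point of $Y$ has a neighborhood $B$ and a $c>0$ with $u\in F^c(B)$; $F_{\rm strict}(K)=\{u\in\mathrm{USC}(K): u|_{\mathrm{Int}K}\in F_{\rm strict}(\mathrm{Int}\,K)\}$. **Boundary convexity.** Write $J^2(X)=\mathbf R\oplus J^2_{\rm red}(X)$, where $\mathbf R$ is the value of the function and $J^2_{\rm red}(X)$ consists of 2-jets of functions vanishing at the point. For $\lambda\in\mathbf R$ define $F_\lambda\subset J^2_{\rm red}(X)$ by $\{\lambda\}\times F_\lambda=F\cap(\{\lambda\}\times J^2_{\rm red}(X))$. Its *asymptotic interior* $\overrightarrow{F_\lambda}$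 is the set of $J\in J^2_{\rm red}(X)$ for which there are a neighborhood $\mathcal N(J)$ of $J$ in the total space $J^2_{\rm red}(X)$ and $t_0>0$ with $t\,\mathcal N(J)\subset F_\lambda$ for all $t\ge t_0$. A local defining function for $\partial\Omega$ near $x\in\partial\Omega$ is a smooth $\rho$ near $x$ with $\partial\Omega=\{\rho=0\}$, $d\rho\ne0$ on $\partial\Omega$ and $\rho<0$ on $\Omega$ near $x$. $\partial\Omega$ is *strictly $F$-convex* if for every $x\in\partial\Omega$ and every $\lambda\in\mathbf R$ there is a local defining function $\rho$ near $x$ whose reduced 2-jet at $x$ lies in $\overrightarrow{F_\lambda}$. **Dirichlet problem.** For $\varphi\in C(\partial\Omega)$ the Perron function is $U=\sup\{u: u\in\mathrm{USC}(\overline\Omega),\ u|_\Omega\in F(\Omega),\ u|_{\partial\Omega}\le\varphi\}$. *)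

(* Defs.v *)
From HB Require Import structures.
From mathcomp Require Import all_boot all_order all_algebra.
From mathcomp Require Import all_classical all_reals all_analysis.

Set Implicit Arguments.
Unset Strict Implicit.
Unset Printing Implicit Defensive.

Import Order.TTheory GRing.Theory Num.Theory.
Import numFieldNormedType.Exports.

Local Open Scope classical_set_scope.
Local Open Scope ring_scope.

Section SymmetricMatrices.
Variables (R : realType) (n : nat).

Definition issym : {pred 'M[R]_n} := fun A => A^T == A.

Fact issym_submod : submod_closed issym.
Proof.
split; first by rewrite unfold_in trmx0.
move=> a A B; rewrite !unfold_in => /eqP hA /eqP hB.
by rewrite linearD linearZ /= hA hB.
Qed.

HB.instance Definition _ :=
  GRing.isSubmodClosed.Build R 'M[R]_n issym issym_submod.

Record symmx := SymMx { symmx_val :> 'M[R]_n; _ : symmx_val \in issym }.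

HB.instance Definition _ := [isSub for symmx_val].
HB.instance Definition _ := [Choice of symmx by <:].
HB.instance Definition _ := [SubChoice_isSubZmodule of symmx by <:].
HB.instance Definition _ := [SubZmodule_isSubLmodule of symmx by <:].
HB.instance Definition _ := Topological.copy symmx (initial_topology symmx_val).

Fact sympart_subproof (A : 'M[R]_n) : 2^-1 *: (A + A^T) \in issym.
Proof. by rewrite unfold_in linearZ linearD /= trmxK addrC. Qed.

Definition sympart (A : 'M[R]_n) : symmx := SymMx (sympart_subproof A).

End SymmetricMatrices.

Section Calculus.
Variables (R : realType) (n : nat).
Implicit Types (U : set 'rV[R]_n) (f : 'rV[R]_n -> R^o) (y z : 'rV[R]_n).

Definition partial (i : 'I_n) f : 'rV[R]_n -> R^o :=
  fun y => 'D_(delta_mx 0 i) f y.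

Fixpoint Ck_on (k : nat) U f : Prop :=
  (forall y, U y -> {for y, continuous f}) /\
  match k with
  | 0 => True
  | k'.+1 => forall i : 'I_n,
      (forall y, U y -> derivable f y (delta_mx 0 i)) /\
      Ck_on k' U (partial i f)
  end.

Definition smooth_on U f := forall k, Ck_on k U f.

Definition jetfib : Type := (R^o * 'rV[R]_n * symmx R n)%type.

HB.instance Definition _ := GRing.Lmodule.on jetfib.
HB.instance Definition _ := Topological.on jetfib.

Definition jval (v : jetfib) : R := v.1.1.
Definition jdiff (v : jetfib) : 'rV[R]_n := v.1.2.
Definition jhess (v : jetfib) : 'M[R]_n := v.2.

(** For [f] of class C^2 the matrix of second partial derivatives is already
    symmetric, so that [sympart] does not change it. *)
Definition coord_jet f y : jetfib :=
  (f y, \row_i partial i f y, sympart (\matrix_(i, j) partial j (partial i f) y)).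

Definition quadratic (y : 'rV[R]_n) (v : jetfib) : 'rV[R]_n -> R^o :=
  fun z => jval v + (jdiff v *m (z - y)^T) 0 0
           + 2^-1 * ((z - y) *m jhess v *m (z - y)^T) 0 0.

End Calculus.

(** [cinv] is only meaningful on [crange], and [cmap] on [cdom]. *)
Record chart (R : realType) (n : nat) (T : topologicalType) := Chart {
  cdom : set T;
  cmap : T -> 'rV[R]_n;
  cinv : 'rV[R]_n -> T;
  crange := cmap @` cdom;
  cdom_open : open cdom;
  crange_open : open crange;
  cmapK : forall x, cdom x -> cinv (cmap x) = x;
  cmap_continuous : forall x, cdom x -> {for x, continuous cmap};
  cinv_continuous : forall y, crange y -> {for y, continuous cinv}
}.

Arguments crange {R n T} c.

(** The domain on which the transition map [cmap c' \o cinv c] is defined. *)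
Definition overlap (R : realType) (n : nat) (T : topologicalType)
  (c c' : chart R n T) : set 'rV[R]_n := cmap c @` (cdom c `&` cdom c').

Definition transition (R : realType) (n : nat) (T : topologicalType)
  (c c' : chart R n T) : 'rV[R]_n -> 'rV[R]_n := cmap c' \o cinv c.

Record manifold (R : realType) (n : nat) := Manifold {
  points :> topologicalType;
  points_hausdorff : hausdorff_space points;
  points_second_countable : @second_countable points;
  atlas : set (chart R n points);
  chart_at : points -> chart R n points;
  chart_at_atlas : forall x, atlas (chart_at x);
  chart_at_dom : forall x, cdom (chart_at x) x;
  transition_smooth : forall c c', atlas c -> atlas c' ->
    forall i : 'I_n, smooth_on (overlap c c') (fun y => transition c c' y 0 i)
}.

Record riemannian_metric (R : realType) (n : nat) (X : manifold R n) :=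
  RiemannianMetric {
  rm_mx : chart R n X -> 'rV[R]_n -> 'M[R]_n;
  rm_sym : forall c y, atlas c -> crange c y -> (rm_mx c y)^T = rm_mx c y;
  rm_pos : forall c y, atlas c -> crange c y ->
    forall w : 'rV[R]_n, w != 0 -> 0 < (w *m rm_mx c y *m w^T) 0 0;
  rm_smooth : forall c, atlas c ->
    forall i j : 'I_n, smooth_on (crange c) (fun y => rm_mx c y i j);
  rm_compat : forall c c', atlas c -> atlas c' -> forall y, overlap c c' y ->
    let D := jacobian (transition c c') y in
    rm_mx c y = D *m rm_mx c' (transition c c' y) *m D^T
}.

(** A 2-jet at [base] is given by its coordinates in the chart
    [chart_at base]; the topology of the total space, below, is the one given by
    the trivializations over all the charts of the atlas. *)
Record jet2 (R : realType) (n : nat) (X : manifold R n) :=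
  Jet { base : X; fib : jetfib R n }.

Arguments Jet {R n X} base fib.

Section Jets.
Variables (R : realType) (n : nat) (X : manifold R n).

HB.instance Definition _ := gen_eqMixin (jet2 X).
HB.instance Definition _ := gen_choiceMixin (jet2 X).

Definition Ck_fun_on (k : nat) (B : set X) (f : X -> R) :=
  forall c, atlas c -> Ck_on k (cmap c @` (B `&` cdom c)) (f \o cinv c).

Definition C2_near (x : X) (f : X -> R) :=
  exists B : set X, [/\ open B, B x & Ck_fun_on 2 B f].

(** J^2_x f, meaningful for [f] of class C^2 near [x]. *)
Definition jet_at (x : X) (f : X -> R) : jetfib R n :=
  coord_jet (f \o cinv (chart_at x)) (cmap (chart_at x) x).

(** The trivialization over the chart [c]: the jet at [cinv c y] of the function
    that reads in [c] as the quadratic polynomial with 2-jet [v] at [y]. *)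
Definition chart_jet (c : chart R n X) (y : 'rV[R]_n) (v : jetfib R n) : jet2 X :=
  Jet (cinv c y) (jet_at (cinv c y) (quadratic y v \o cmap c)).

Definition jet2_open (W : set (jet2 X)) := forall c, atlas c ->
  open [set p : 'rV[R]_n * jetfib R n | crange c p.1 /\ W (chart_jet c p.1 p.2)].

Fact jet2_openT : jet2_open setT.
Proof.
move=> c _; rewrite (_ : [set _ | _] = fst @^-1` crange c).
  by apply: open_comp; [move=> p _; exact: cvg_fst | exact: crange_open].
by apply/seteqP; split => p /= => [[]|].
Qed.

Fact jet2_openI : setI_closed jet2_open.
Proof.
move=> A B hA hB c hc.
rewrite (_ : [set _ | _] =
  [set p : 'rV[R]_n * jetfib R n | crange c p.1 /\ A (chart_jet c p.1 p.2)] `&`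
  [set p : 'rV[R]_n * jetfib R n | crange c p.1 /\ B (chart_jet c p.1 p.2)]).
  by apply: openI; [exact: hA | exact: hB].
by apply/seteqP; split => p /= => [[? []]|[[? ?] []]].
Qed.

Fact jet2_open_bigU (I : Type) (f : I -> set (jet2 X)) :
  (forall i, jet2_open (f i)) -> jet2_open (\bigcup_i f i).
Proof.
move=> hf c hc.
rewrite (_ : [set _ | _] = \bigcup_i
  [set p : 'rV[R]_n * jetfib R n | crange c p.1 /\ f i (chart_jet c p.1 p.2)]).
  by apply: bigcup_open => i _; exact: hf.
apply/seteqP; split => p /= => [[? [i _ ?]]|[i _ [? ?]]].
  by exists i.
by split => //; exists i.
Qed.

HB.instance Definition _ :=
  isOpenTopological.Build (jet2 X) jet2_openT jet2_openI jet2_open_bigU.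

Implicit Types (F : set (jet2 X)) (x : X).

Definition fibre F x : set (jetfib R n) := [set v | F (Jet x v)].

Definition Pjets x : set (jetfib R n) :=
  [set v | [/\ jval v = 0, jdiff v = 0 &
               forall w : 'rV[R]_n, 0 <= (w *m jhess v *m w^T) 0 0]].

Definition Njets x : set (jetfib R n) := [set jet_at x (cst r) | r in [set r | r <= 0]].

Record subequation F : Prop := {
  subeq_P : forall x v w, fibre F x v -> Pjets x w -> fibre F x (v + w);
  subeq_N : forall x v w, fibre F x v -> Njets x w -> fibre F x (v + w);
  subeq_T : F = closure F°;
  subeq_T_fibre : forall x, fibre F x = closure (fibre F x)°;
  subeq_T_int : forall x, (fibre F x)° = fibre F° x
}.

Definition dual F : set (jet2 X) := [set J | ~ F° (Jet (base J) (- fib J))].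

(** Functions on a subset of [X] are represented by functions on [X], of which
    only the values on that subset matter. *)

Definition boundary (A : set X) : set X := closure A `\` A°.

Definition usc_on (Y : set X) (u : X -> \bar R) := forall x, Y x ->
  (u x < +oo)%E /\
  forall a : R, (u x < a%:E)%E -> \forall z \near within Y (nbhs x), (u z < a%:E)%E.

Definition subharmonic F (Y : set X) (u : X -> \bar R) :=
  usc_on Y u /\
  forall x (phi : X -> R), Y x -> C2_near x phi ->
    (\forall z \near x, (u z - (phi z)%:E <= 0)%E) -> (u x - (phi x)%:E = 0)%E ->
    F (Jet x (jet_at x phi)).

Definition harmonic F (Y : set X) (u : X -> \bar R) :=
  subharmonic F Y u /\ subharmonic (dual F) Y (fun x => - u x)%E.

Definition subharmonic_cpt F (K : set X) (u : X -> \bar R) :=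
  usc_on K u /\ subharmonic F K° u.

Definition comparison F := forall (K : set X) (u v : X -> \bar R),
  compact K -> subharmonic_cpt F K u -> subharmonic_cpt (dual F) K v ->
  (forall x, boundary K x -> (u x + v x <= 0)%E) ->
  forall x, K x -> (u x + v x <= 0)%E.

Record jet_metric := JetMetric {
  jm :> X -> jetfib R n -> jetfib R n -> R;
  jm_linear : forall x w (a : R) v v', jm x (a *: v + v') w = a * jm x v w + jm x v' w;
  jm_sym : forall x v w, jm x v w = jm x w v;
  jm_pos : forall x v, v != 0 -> 0 < jm x v v;
  jm_smooth : forall c v w, atlas c ->
    smooth_on (crange c)
      (fun y => jm (cinv c y) (fib (chart_jet c y v)) (fib (chart_jet c y w)))
}.

Variable G : jet_metric.

Definition jdist x (v w : jetfib R n) : R := Num.sqrt (G x (v - w) (v - w)).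

(** The infimum is [+oo] if the fibre of [F] is the full space of jets. *)
Definition strict_part F (c : R) : set (jet2 X) :=
  [set J | F J /\
    (c%:E <= ereal_inf [set (jdist (base J) (fib J) w)%:E
                       | w in ~` fibre F (base J)])%E].

Definition strict_subharmonic F (Y : set X) (u : X -> \bar R) :=
  forall x, Y x -> exists (B : set X) (c : R),
    [/\ open B, B x, B `<=` Y, 0 < c & subharmonic (strict_part F c) B u].

Definition strict_subharmonic_cpt F (K : set X) (u : X -> \bar R) :=
  usc_on K u /\ strict_subharmonic F K° u.

Definition bounded_below_on (K : set X) (u : X -> \bar R) :=
  exists m : R, forall x, K x -> (m%:E <= u x)%E.

Definition jet_red : set (jet2 X) := [set J | jval (fib J) = 0].

Definition slice F (lambda : R) : set (jet2 X) :=
  [set J | jet_red J /\ F (Jet (base J) (jet_at (base J) (cst lambda) + fib J))].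

Definition asymptotic_interior (A : set (jet2 X)) : set (jet2 X) :=
  [set J | jet_red J /\
    exists (V : set (jet2 X)) (t0 : R),
      [/\ V `<=` jet_red, within jet_red (nbhs J) V, 0 < t0 &
          forall t J', t0 <= t -> V J' -> A (Jet (base J') (t *: fib J'))]].

Definition local_defining_function (Omega : set X) (x : X) (rho : X -> R) :=
  exists B : set X,
    [/\ open B, B x, (forall k, Ck_fun_on k B rho),
        (forall z, B z -> boundary Omega z <-> rho z = 0) &
        (forall z, B z -> boundary Omega z -> jdiff (jet_at z rho) != 0) /\
        (forall z, B z -> Omega z -> rho z < 0)].

Definition smooth_boundary (Omega : set X) :=
  forall x, boundary Omega x -> exists rho, local_defining_function Omega x rho.

Definition strictly_convex_boundary F (Omega : set X) :=
  forall x (lambda : R), boundary Omega x ->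
    exists rho, local_defining_function Omega x rho /\
      asymptotic_interior (slice F lambda) (Jet x (jet_at x rho)).

Record smooth_domain (Omega : set X) : Prop := {
  dom_open : open Omega;
  dom_connected : connected Omega;
  dom_nonempty : Omega !=set0;
  dom_relatively_compact : compact (closure Omega);
  dom_smooth_boundary : smooth_boundary Omega
}.

Definition perron_family F (Omega : set X) (phi : X -> R) : set (X -> \bar R) :=
  [set u | [/\ usc_on (closure Omega) u, subharmonic F Omega u &
               forall x, boundary Omega x -> (u x <= (phi x)%:E)%E]].

Definition perron F (Omega : set X) (phi : X -> R) : X -> \bar R :=
  fun x => ereal_sup [set u x | u in perron_family F Omega phi].

Definition real_continuous_on (K : set X) (u : X -> \bar R) :=
  (forall x, K x -> u x \is a fin_num) /\ {within K, continuous (fine \o u)}.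

Definition dirichlet_solution F (Omega : set X) (phi : X -> R) (u : X -> \bar R) :=
  [/\ real_continuous_on (closure Omega) u,
      harmonic F Omega u &
      forall x, boundary Omega x -> u x = (phi x)%:E].

End Jets.

(* Main.v *)
Require Import Defs.
From HB Require Import structures.
From mathcomp Require Import all_boot all_order all_algebra.
From mathcomp Require Import all_classical all_reals all_analysis.
From mathcomp Require Import ring lra.
Import Order.TTheory GRing.Theory Num.Theory.
Import numFieldNormedType.Exports.
Local Open Scope classical_set_scope.
Local Open Scope ring_scope.

Set Implicit Arguments.
Unset Strict Implicit.
Unset Printing Implicit Defensive.

(** Perron's method. The usc regularization of the Perron function [U] is
    F-subharmonic, because [F] is closed: a test function touching it from above
    touches, after a small quadratic perturbation, some member of the family at a
    nearby point. Gluing the barriers furnished by strict F-convexity to a global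
    subharmonic function that is bounded below shows that [U] is at least [phi] in
    the limit at the boundary; the same barriers for the dual together with comparison
    give the upper bound. So the regularization belongs to the family and equals [U].
    If the usc regularization of [-U] failed to be subharmonic for the dual, [U] could
    be raised near a point by a smooth function with jets in [F], against maximality.
    Comparison of [U] with that regularization gives continuity. *)

(** The jet of a function at [z] is read in [chart_at z], which may vary with [z] in any manner,
    whereas openness of a set of jets is tested in a fixed chart. The calculus up to [jet_at_chart]
    therefore shows that 2-jets transform consistently under chart changes; [jet_stable] condenses
    this into the one statement behind every perturbation argument. Functions bounded below are what
    makes barriers global: away from the boundary point a barrier can be pushed below a constant,
    but not below a function that may tend to minus infinity. Since [F] may depend on the value of
    the function, strict convexity at level [lambda] speaks of jets of value exactly [lambda], while
    the barrier drops below [lambda] inside the domain; (N) bridges this gap. Comparison enters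
    once: a member of the family for [F] and [phi] plus a member of the family for the dual and
    [- phi] is nonpositive on the closure. Each of the two regularizations is then shown to lie in
    its family. *)

Lemma continuous_bigsum (R : realType) (T : topologicalType) m (h : 'I_m -> T -> R) (x : T) :
  (forall i, {for x, continuous (h i)}) -> {for x, continuous (fun y => \sum_i h i y)}.
Proof. by move=> H; apply: cvg_big => [|i _]; [exact: add_continuous|exact: H]. Qed.

Lemma near_forall (T : topologicalType) (I : finType) (y : T) (P : I -> T -> Prop) :
  (forall i, \forall z \near y, P i z) -> \forall z \near y, forall i, P i z.
Proof. by move=> H; exact: (@filter_forall T I P (nbhs y) (nbhs_filter y) H). Qed.

Lemma continuous_near_eq (R : realType) (T : topologicalType) (f g : T -> R^o) (y : T) :
  (\forall z \near y, f z = g z) -> {for y, continuous f} -> {for y, continuous g}.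
Proof.
move=> fg; rewrite /prop_for /continuous_at (nbhs_singleton fg).
by apply: cvg_trans; exact: near_eq_cvg.
Qed.

(** * Continuous partial derivatives imply differentiability *)

Section Coordinates.
Variables (R : realType) (n : nat).
Notation V := 'rV[R]_n.
Implicit Types (U W : set V) (f g : V -> R^o) (y z v : V) (i j : 'I_n).

Lemma is_derive_line f a v (s : R) : derivable f (s *: v + a) v ->
  is_derive s (1 : R) (fun t : R => f (t *: v + a)) ('D_v f (s *: v + a)).
Proof.
move=> df.
have E : (fun h : R => h^-1 *: (((fun t : R => f (t *: v + a)) \o shift s) (h *: (1 : R))
            - f (s *: v + a))) =
         (fun h => h^-1 *: ((f \o shift (s *: v + a)) (h *: v) - f (s *: v + a))).
  by apply/funext => h /=; rewrite scalerDl addrA [h *: 1]mulr1.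
by split; rewrite /derivable /derive E.
Qed.

(** Mean value theorem along one coordinate axis, applied on the segment from 0 to [t] or from [t]
    to 0 according to the sign of [t]. *)
Lemma increment_bound f i a (t p e : R) :
  (forall s, `|s| <= `|t| -> derivable f (s *: delta_mx 0 i + a) (delta_mx 0 i) /\
     `|partial i f (s *: delta_mx 0 i + a) - p| <= e) ->
  `|f (t *: delta_mx 0 i + a) - f a - t * p| <= e * `|t|.
Proof.
move=> H.
set g := fun s : R => (f (s *: delta_mx 0 i + a) : R).
have dg s : `|s| <= `|t| -> is_derive s (1 : R) g (partial i f (s *: delta_mx 0 i + a)).
  by move=> /H[d _]; exact: is_derive_line.
have cg s : `|s| <= `|t| -> {for s, continuous g}.
  move=> /dg d; apply: differentiable_continuous; exact/derivable1_diffP.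
have g0 : f a = g 0 by rewrite /g scale0r add0r.
have gt : f (t *: delta_mx 0 i + a) = g t by [].
have [t0|t0] := leP 0 t.
- have [||c] := @MVT_segment R g (fun s => partial i f (s *: delta_mx 0 i + a)) 0 t t0.
  + move=> s; rewrite in_itv /= => /andP[s0 st]; apply: dg.
    by rewrite !ger0_norm // ltW.
  + apply: continuous_in_subspaceT => s; rewrite inE /= in_itv /= => /andP[s0 st].
    by apply: cg; rewrite !ger0_norm.
  rewrite in_itv /= subr0 => /andP[c0 ct] E.
  rewrite gt g0 E mulrC -mulrBr normrM mulrC ler_wpM2r //.
  by case: (H c) => //; rewrite !ger0_norm.
- have [||c] := @MVT_segment R g (fun s => partial i f (s *: delta_mx 0 i + a)) t 0 (ltW t0).
  + move=> s; rewrite in_itv /= => /andP[s0 st]; apply: dg.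
    by rewrite !ltr0_norm // lerN2 ltW.
  + apply: continuous_in_subspaceT => s; rewrite inE /= in_itv /= => /andP[s0 st].
    by apply: cg; rewrite !ler0_norm ?lerN2 // ltW.
  rewrite in_itv /= sub0r => /andP[c0 ct] E.
  have -> : f (t *: delta_mx 0 i + a) - f a - t * p =
     t * (partial i f (c *: delta_mx 0 i + a) - p).
    by rewrite gt g0 -[X in X - _]opprB E; ring.
  rewrite normrM mulrC ler_wpM2r //.
  by case: (H c) => //; rewrite !ler0_norm ?lerN2 // ltW.
Qed.

Definition rowdot (a w : V) : R^o := \sum_i w 0 i * a 0 i.

Lemma rowdot_linear a : linear (rowdot a).
Proof.
move=> k u w; rewrite /rowdot scaler_sumr -big_split; apply: eq_bigr => i _ /=.
by rewrite !mxE mulrDl -mulrA.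
Qed.

HB.instance Definition _ a := GRing.isLinear.Build R V R^o _ (rowdot a) (rowdot_linear a).

Lemma rowdot_continuous a : continuous (rowdot a).
Proof.
move=> w; apply: (@continuous_bigsum R V n (fun i x => x 0 i * a 0 i)) => i.
by apply: continuousM; [exact: coord_continuous|exact: cst_continuous].
Qed.

Lemma near_norm y (e : R) : 0 < e -> \forall z \near y, `|z - y| < e.
Proof.
by move=> e0; apply/nbhs_ballP; exists e => // z; rewrite -ball_normE /= distrC.
Qed.

Lemma norm_delta_mx i : `|delta_mx 0 i : V| <= 1.
Proof.
rewrite [leLHS]/Num.Def.normr /= mx_normrE; apply/bigmax_leP; split => // -[k l] _ /=.
by rewrite mxE; case: (_ && _); rewrite ?normr1 ?normr0.
Qed.

Lemma coord_le_norm (w : V) i : `|w 0 i| <= `|w|.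
Proof.
by rewrite [leRHS]/Num.Def.normr /= mx_normrE; apply: (le_bigmax _ _ (0, i)).
Qed.

(** The vertices of the path from 0 to [w] that moves along one coordinate axis at a time. *)
Definition trunc (k : nat) (w : V) : V := \row_j (if (j < k)%N then w 0 j else 0).

Lemma truncS (w : V) i : trunc i.+1 w = w 0 i *: delta_mx 0 i + trunc i w.
Proof.
apply/rowP => j; rewrite !mxE eqxx /= ltnS.
have [->|ne] := eqVneq j i; first by rewrite leqnn ltnn mulr1 addr0.
by rewrite mulr0 add0r leq_eqVlt (negbTE (ne : (j : nat) != i)).
Qed.

Lemma norm_trunc k (w : V) : `|trunc k w| <= `|w|.
Proof.
rewrite [leLHS]/Num.Def.normr /= mx_normrE; apply/bigmax_leP; split => // -[a l] _ /=.
by rewrite mxE; case: ifP => _; rewrite ?normr0 // coord_le_norm.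
Qed.

Definition gradient f y : V := \row_i partial i f y.

(** The increment telescopes over the truncations of [w]; each of the [n] steps is parallel to an
    axis, where [increment_bound] applies. *)
Lemma total_increment f y (e : R) : 0 < e ->
  (forall i, \forall z \near y, derivable f z (delta_mx 0 i)) ->
  (forall i, {for y, continuous (partial i f)}) ->
  \forall w \near (0 : V), `|f (w + y) - f y - rowdot (gradient f y) w| <= e * `|w|.
Proof.
move=> e0 df cf.
(* The tolerance is shared among [n.+1] rather than [n] steps, so that the quotient makes sense for
   [n = 0]. *)
have N0 : 0 < n.+1%:R :> R by rewrite ltr0n.
have d0 : 0 < e / n.+1%:R by rewrite divr_gt0.
have : \forall z \near y, forall i, derivable f z (delta_mx 0 i) /\
    `|partial i f z - partial i f y| <= e / n.+1%:R.
  apply: (@near_forall V 'I_n y (fun i z => derivable f z (delta_mx 0 i) /\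
    `|partial i f z - partial i f y| <= e / n.+1%:R)) => i.
  near=> z; split; first by near: z; exact: df.
  rewrite distrC; near: z.
    by have /cvgrPdist_le := cf i; apply.
case/nbhs_ballP => r /= r0 H.
near=> w.
(* One half of [r] is for the truncation already reached, the other for the move along the next
   axis. *)
have wr : `|w| < r / 2.
  by rewrite -[w]subr0; near: w; apply: near_norm; rewrite divr_gt0.
have step k : (k <= n)%N -> `|f (trunc k w + y) - f y -
     \sum_(i < n | (i < k)%N) w 0 i * gradient f y 0 i| <= (e / n.+1%:R) * `|w| *+ k.
  elim: k => [_|k IH kn].
    rewrite mulr0n big_pred0 // subr0 (_ : trunc 0 w = 0) ?add0r ?subrr ?normr0 //.
    by apply/rowP => j; rewrite !mxE.
  pose i := Ordinal kn.
  rewrite (bigD1 i) //=.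
  rewrite (eq_bigl (fun j : 'I_n => (j < k)%N)); last first.
    by move=> j; rewrite ltnS -val_eqE /= andbC -ltn_neqAle.
  rewrite (truncS w i) -[_ + trunc i w + y]addrA [gradient f y 0 i]mxE.
  have := IH (ltnW kn); set S := \sum_(_ < _ | _) _ => IHk.
  have := @increment_bound f i (trunc i w + y) (w 0 i) (partial i f y) (e / n.+1%:R).
  set A := f (_ + (_ + _)); move=> /= D.
  rewrite (_ : A - _ - _ = (A - f (trunc k w + y) - w 0 i * partial i f y) +
    (f (trunc k w + y) - f y - S)); last by ring.
  rewrite (le_trans (ler_normD _ _)) // mulrS lerD //.
  rewrite (le_trans (D _)) //; last first.
    by rewrite ler_wpM2l ?coord_le_norm // ltW.
  move=> s sw; apply: H.
  rewrite -ball_normE /= addrA opprD addrA [y - _ - y]addrAC.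
  rewrite subrr sub0r normrN (le_lt_trans (ler_normD _ _)) //.
  rewrite [ltRHS]splitr ltr_leD //; last by rewrite (le_trans (norm_trunc _ _)) // ltW.
  rewrite normrZ (le_lt_trans _ wr) // (le_trans _ (coord_le_norm w i)) //.
  by rewrite (le_trans _ sw) // ler_piMr // norm_delta_mx.
have := step n (leqnn n).
rewrite (_ : trunc n w = w); last by apply/rowP => j; rewrite mxE ltn_ord.
rewrite (eq_bigl xpredT); last by move=> j; rewrite ltn_ord.
rewrite /rowdot => /le_trans -> //.
rewrite -mulr_natr mulrAC ler_wpM2r //.
by rewrite -mulrA ler_piMr ?(ltW e0) // ler_pdivrMl // mulr1 ler_nat.
Unshelve. all: by end_near. Qed.

Lemma differentiable_C1 f y :
  (forall i, \forall z \near y, derivable f z (delta_mx 0 i)) ->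
  (forall i, {for y, continuous (partial i f)}) ->
  differentiable f y /\ (forall w, 'd f y w = rowdot (gradient f y) w).
Proof.
move=> df cf.
have c := @rowdot_continuous (gradient f y).
have E : f \o shift y = cst (f y) + rowdot (gradient f y) +o_ (0 : V) id.
  apply/eqaddoP => _/posnumP[e]; near=> w.
  rewrite /= opprD addrA.
  by near: w; exact: total_increment.
have D := diff_unique c E.
split; last by move=> w; rewrite D.
by apply/diff_locallyP; rewrite D.
Unshelve. all: by end_near. Qed.

End Coordinates.

(** * Functions of class C^k on open sets *)

Section CkCalculus.
Variables (R : realType) (n : nat).
Notation V := 'rV[R]_n.
Implicit Types (U W : set V) (f g : V -> R^o) (y z v : V) (i j : 'I_n).

Lemma Ck_continuous k U f y : Ck_on k U f -> U y -> {for y, continuous f}.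
Proof. by case: k => [|k] [+ _]; apply. Qed.

Lemma CkS k U f : Ck_on k.+1 U f -> Ck_on k U f.
Proof.
elim: k f => [|k IH] f [cf Hf]; split=> // i.
by have [d Hi] := Hf i; split=> //; exact: IH.
Qed.

Lemma Ck_le k l U f : (k <= l)%N -> Ck_on l U f -> Ck_on k U f.
Proof.
elim: l => [|l IH]; first by rewrite leqn0 => /eqP ->.
by rewrite leq_eqVlt => /predU1P[->//|kl] /CkS; exact: IH.
Qed.

Lemma Ck_sub k U W f : W `<=` U -> Ck_on k U f -> Ck_on k W f.
Proof.
move=> WU; elim: k f => [|k IH] f [cf Hf]; split=> //; try by move=> y /WU; exact: cf.
move=> i; by have [d Hi] := Hf i; split=> [y /WU|]; [exact: d|exact: IH].
Qed.

Lemma open_near_eq U f g y : open U -> (forall z, U z -> f z = g z) -> U y ->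
  \forall z \near y, f z = g z.
Proof.
by move=> oU fg Uy; near=> z; apply: fg; near: z; exact: open_nbhs_nbhs.
Unshelve. all: by end_near. Qed.

Lemma partial_near f g y i : (\forall z \near y, f z = g z) ->
  partial i f y = partial i g y.
Proof. by move=> /near_eq_derive; exact. Qed.

Lemma Ck_ext k U f g : open U -> (forall z, U z -> f z = g z) ->
  Ck_on k U f -> Ck_on k U g.
Proof.
move=> oU; elim: k f g => [|k IH] f g fg [cf Hf].
  by split=> // y Uy; apply: continuous_near_eq (open_near_eq oU fg Uy) (cf y Uy).
split=> [y Uy|i].
  exact: continuous_near_eq (open_near_eq oU fg Uy) (cf y Uy).
have [d Hi] := Hf i; split=> [y Uy|].
  exact: near_eq_derivable (open_near_eq oU fg Uy) (d y Uy).
by apply: IH Hi => y Uy; exact: partial_near (open_near_eq oU fg Uy).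
Qed.

Lemma partial_cst i (c : R) : partial i (cst c) = cst 0.
Proof. by apply/funext => y; rewrite /partial derive_cst. Qed.

Lemma Ck_cst k U (c : R) : Ck_on k U (cst c).
Proof.
elim: k c => [|k IH] c; split=> //; try by move=> y _; exact: cst_continuous.
move=> i; split=> [y _|]; first exact: derivable_cst.
rewrite partial_cst; exact: IH.
Qed.

Lemma Ck_add k U f g : open U -> Ck_on k U f -> Ck_on k U g -> Ck_on k U (f \+ g).
Proof.
move=> oU; elim: k f g => [|k IH] f g [cf Hf] [cg Hg].
  by split=> // y Uy; apply: continuousD; [exact: cf|exact: cg].
split=> [y Uy|i]; first by apply: continuousD; [exact: cf|exact: cg].
have [df Ckf] := Hf i; have [dg Ckg] := Hg i.
split=> [y Uy|]; first by apply: derivableD; [exact: df|exact: dg].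
apply: (@Ck_ext _ _ (partial i f \+ partial i g)) => //; last exact: IH.
by move=> z Uz; rewrite /partial /= -deriveD //; [exact: df|exact: dg].
Qed.

Lemma Ck_mul k U f g : open U -> Ck_on k U f -> Ck_on k U g -> Ck_on k U (f \* g).
Proof.
move=> oU; elim: k f g => [|k IH] f g [cf Hf] [cg Hg].
  by split=> // y Uy; apply: continuousM; [exact: cf|exact: cg].
split=> [y Uy|i]; first by apply: continuousM; [exact: cf|exact: cg].
have [df Ckf] := Hf i; have [dg Ckg] := Hg i.
have Ckf0 : Ck_on k U f by apply: CkS; split.
have Ckg0 : Ck_on k U g by apply: CkS; split.
split=> [y Uy|]; first by apply: derivableM; [exact: df|exact: dg].
apply: (@Ck_ext _ _ ((f \* partial i g) \+ (g \* partial i f))) => //.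
  by move=> z Uz; rewrite /partial /= deriveM //; [exact: df|exact: dg].
by apply: Ck_add => //; exact: IH.
Qed.

Lemma Ck_scale k U f (c : R) : open U -> Ck_on k U f -> Ck_on k U (fun y => c * f y).
Proof. by move=> oU Hf; apply: (@Ck_mul k U (cst c)) => //; exact: Ck_cst. Qed.

Lemma Ck_sum k U m (h : 'I_m -> V -> R^o) : open U ->
  (forall l, Ck_on k U (h l)) -> Ck_on k U (fun y => \sum_l h l y).
Proof.
move=> oU Hf; rewrite (_ : (fun _ => _) = \big[(fun f g => f \+ g)/cst 0]_l h l).
  by elim/big_ind: _ => //; [exact: Ck_cst|move=> *; exact: Ck_add].
by apply/funext => y; elim/big_rec2: _ => //= l a b _ ->.
Qed.

Lemma C1_differentiable U f y : open U -> Ck_on 1 U f -> U y ->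
  differentiable f y /\ (forall w, 'd f y w = rowdot (gradient f y) w).
Proof.
move=> oU [cf Hf] Uy; apply: differentiable_C1 => i; have [d [c _]] := Hf i.
  by near=> z; apply: d; near: z; exact: open_nbhs_nbhs.
exact: c.
Unshelve. all: by end_near. Qed.

Lemma partial_val f y i df : is_derive y (delta_mx 0 i) f df -> partial i f y = df.
Proof. by move=> h; exact: derive_val. Qed.

Lemma is_derive_partial f y i : derivable f y (delta_mx 0 i) ->
  is_derive y (delta_mx 0 i) f (partial i f y).
Proof. exact: derivableP. Qed.

Lemma partialD f g y i : derivable f y (delta_mx 0 i) -> derivable g y (delta_mx 0 i) ->
  partial i (f \+ g) y = partial i f y + partial i g y.
Proof. exact: deriveD. Qed.

Lemma partialZ f (c : R) y i : derivable f y (delta_mx 0 i) ->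
  partial i (fun z => c * f z) y = c * partial i f y.
Proof. exact: (@deriveZ R V R^o). Qed.

Lemma rowdot_delta (a : V) i : rowdot a (delta_mx 0 i) = a 0 i.
Proof.
rewrite /rowdot (bigD1 i) //= big1 ?addr0 ?mxE ?eqxx ?mul1r // => j ji.
by rewrite mxE (negbTE ji) mul0r.
Qed.

Lemma rowdot_deltal (w : V) i : rowdot (delta_mx 0 i) w = w 0 i.
Proof.
rewrite /rowdot (bigD1 i) //= big1 ?addr0 ?mxE ?eqxx ?mulr1 // => j ji.
by rewrite mxE (negbTE ji) mulr0.
Qed.

Lemma derive_C1 U f y w : open U -> Ck_on 1 U f -> U y ->
  'D_w f y = rowdot (gradient f y) w.
Proof. by move=> oU Hf Uy; have [d <-] := C1_differentiable oU Hf Uy; rewrite deriveE. Qed.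

(** For [a = delta_mx 0 j] this is the [j]-th coordinate of [z - p]; all explicit test functions are
    sums of products of such forms. *)
Definition affine (a p : V) : V -> R^o := fun z => rowdot a (z - p).

Lemma affineE a p : affine a p = fun z => rowdot a z + cst (- rowdot a p) z.
Proof. by apply/funext => z; rewrite /affine raddfB. Qed.

Lemma is_derive_rowdot a z w : is_derive z w (rowdot a) (rowdot a w).
Proof.
have d : differentiable (rowdot a) z.
  by apply: linear_differentiable; exact: rowdot_continuous.
split; first exact: diff_derivable.
by rewrite deriveE // diff_lin //; exact: rowdot_continuous.
Qed.

Lemma is_derive_affine a p z w : is_derive z w (affine a p) (rowdot a w).
Proof.
rewrite affineE; have h := is_derive_rowdot a z w.
have h' := @is_derive_cst R V R^o (- rowdot a p) z w.
by have := is_deriveD h h'; rewrite addr0.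
Qed.

Lemma partial_affine a p i : partial i (affine a p) = cst (a 0 i).
Proof.
apply/funext => z; have h := is_derive_affine a p z (delta_mx 0 i).
by rewrite /partial derive_val rowdot_delta.
Qed.

Lemma Ck_affine k U a p : Ck_on k U (affine a p).
Proof.
have c : continuous (affine a p).
  move=> z; rewrite affineE; apply: continuousD; last exact: cst_continuous.
  exact: rowdot_continuous.
case: k => [|k]; split; [by move=> y _; exact: c|by []|by move=> y _; exact: c|].
move=> i; split; last by rewrite partial_affine; exact: Ck_cst.
by move=> y _; have [] := is_derive_affine a p y (delta_mx 0 i).
Qed.

Section Composition.
Variables (T : V -> V) (U W : set V).
Hypotheses (oU : open U) (oW : open W) (TUW : forall y, U y -> W (T y)).
Hypothesis cT : forall y, U y -> {for y, continuous T}.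

Lemma partial_comp f i y : (forall j, Ck_on 1 U (fun z => T z 0 j)) -> Ck_on 1 W f -> U y ->
  derivable (f \o T) y (delta_mx 0 i) /\
  partial i (f \o T) y = \sum_j partial j f (T y) * partial i (fun z => T z 0 j) y.
Proof.
move=> HT Hf Uy.
have dT : differentiable T y.
  rewrite (_ : T = \sum_(j < n) (fun z => T z 0 j *: (delta_mx 0 j : V))); last first.
    apply/funext => z; rewrite fct_sumE.
    by apply/rowP => j; rewrite [in LHS](row_sum_delta (T z)).
  apply: differentiable_sum => j; apply: differentiableZl.
  exact: (C1_differentiable oU (HT j) Uy).1.
have [df Ef] := C1_differentiable oW Hf (TUW Uy).
have dfT : differentiable (f \o T) y by exact: differentiable_comp.
split; first exact: diff_derivable.
rewrite /partial (deriveE _ dfT) (diff_comp dT df) [LHS]Ef /rowdot; apply: eq_bigr => j _.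
rewrite mxE mulrC; congr (_ * _).
by rewrite -(deriveE _ dT) (derive_mx (diff_derivable dT)) mxE.
Qed.

(** By the chain rule the partial derivatives of [f \o T] are sums of products, in which the
    induction hypothesis handles the factors [partial j f \o T]. *)
Lemma Ck_comp k f : (forall j, Ck_on k U (fun z => T z 0 j)) -> Ck_on k W f ->
  Ck_on k U (f \o T).
Proof.
elim: k f => [|k IH] f HT Hf.
  split=> // y Uy; apply: continuous_comp; first exact: cT.
  by apply: Ck_continuous Hf _; exact: TUW.
have HT1 j : Ck_on 1 U (fun z => T z 0 j) by apply: Ck_le (HT j).
have Hf1 : Ck_on 1 W f by apply: Ck_le Hf.
split=> [y Uy|i].
  by apply: continuous_comp; [exact: cT|apply: Ck_continuous Hf _; exact: TUW].
split=> [y Uy|]; first exact: (partial_comp i HT1 Hf1 Uy).1.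
apply: (@Ck_ext _ _ (fun y => \sum_j (partial j f \o T) y * partial i (fun z => T z 0 j) y)) => //.
  by move=> z Uz; rewrite (partial_comp i HT1 Hf1 Uz).2.
apply: Ck_sum => // j; apply: Ck_mul => //.
  apply: IH; last by have [_ /(_ j)[]] := Hf.
  by move=> l; exact: CkS.
by have [_ /(_ i)[]] := HT j.
Qed.

End Composition.
End CkCalculus.

(** * 2-jets in coordinates *)

Section JetTopology.
Variables (R : realType) (n : nat) (T : topologicalType).
Implicit Types (x : T).

Lemma continuous_entries m p (M : T -> 'M[R]_(m, p)) x :
  (forall i j, {for x, continuous (fun z => M z i j)}) -> {for x, continuous M}.
Proof.
move=> cM A [P MP sPA]; rewrite nbhs_filterE.
have := @near_forall T 'I_m x (fun i z => forall j, P i j (M z i j)).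
have H i : \forall z \near x, forall j, P i j (M z i j).
  apply: (@near_forall T 'I_p x (fun j z => P i j (M z i j))) => j.
  exact: (cM i j _ (MP i j)).
move=> /(_ H); apply: filterS => z Hz; apply: sPA => i j; exact: Hz.
Qed.

Lemma continuous_symmx (f : T -> symmx R n) x :
  {for x, continuous (fun z => symmx_val (f z))} -> {for x, continuous f}.
Proof.
move=> cf A [B /= [[W oW <-]]] /= Wx /filterS; apply; apply: cf.
exact: open_nbhs_nbhs.
Qed.

Lemma continuous_jet (J : T -> jetfib R n) x :
  {for x, continuous (fun z => jval (J z) : R)} ->
  (forall i, {for x, continuous (fun z => jdiff (J z) 0 i)}) ->
  (forall i j, {for x, continuous (fun z => jhess (J z) i j)}) ->
  {for x, continuous J}.
Proof.
move=> c0 c1 c2.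
rewrite (_ : J = fun z => ((jval (J z), jdiff (J z)), (J z).2)); last first.
  by apply/funext => z; rewrite /jval /jdiff; case: (J z) => -[].
have h1 : {for x, continuous (fun z => jdiff (J z))}.
  by apply: continuous_entries => i j; rewrite ord1; exact: c1.
have h2 : {for x, continuous (fun z => (J z).2)}.
  by apply: continuous_symmx; apply: continuous_entries => i j; exact: c2.
exact: (cvg_pair (cvg_pair c0 h1) h2).
Qed.

End JetTopology.

Section JetCoordinates.
Variables (R : realType) (n : nat).
Notation J := (jetfib R n).


Lemma jdiffDi (v w : J) i : jdiff (v + w) 0 i = jdiff v 0 i + jdiff w 0 i.
Proof. by rewrite mxE. Qed.
Lemma jhessDi (v w : J) i j : jhess (v + w) i j = jhess v i j + jhess w i j.
Proof. by rewrite mxE. Qed.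
Lemma jdiffZi (a : R) (v : J) i : jdiff (a *: v) 0 i = a * jdiff v 0 i.
Proof. by rewrite mxE. Qed.
Lemma jhessZi (a : R) (v : J) i j : jhess (a *: v) i j = a * jhess v i j.
Proof. by rewrite mxE. Qed.

Lemma jetP (v w : J) : jval v = jval w -> jdiff v = jdiff w -> jhess v = jhess w -> v = w.
Proof.
case: v => [[a b] c]; case: w => [[a' b'] c']; rewrite /jval /jdiff /jhess /= => -> -> h.
by congr pair; apply: val_inj.
Qed.

Lemma jhess_sym (v : J) i j : jhess v i j = jhess v j i.
Proof.
case: v => [[a b] [A /= hA]]; rewrite /jhess /=.
by move: hA; rewrite unfold_in => /eqP {1}<-; rewrite mxE.
Qed.

Lemma jval_continuous : continuous (fun v : J => jval v : R).
Proof. by move=> v; apply: (@cvg_comp _ _ _ fst fst _ (nbhs v.1)); [exact: cvg_fst|exact: cvg_fst]. Qed.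

Lemma jdiff_continuous i : continuous (fun v : J => jdiff v 0 i).
Proof.
move=> v; apply: (@continuous_comp _ _ _ (fun v : J => jdiff v) (fun M => M 0 i)); last exact: coord_continuous.
by apply: (@cvg_comp _ _ _ fst snd _ (nbhs v.1)); [exact: cvg_fst|exact: cvg_snd].
Qed.

Lemma jhess_continuous i j : continuous (fun v : J => jhess v i j).
Proof.
move=> v; apply: (@continuous_comp _ _ _ (fun v : J => jhess v) (fun M => M i j)); last exact: coord_continuous.
apply: (@continuous_comp _ _ _ (fun v : J => v.2) (@symmx_val R n)); first exact: cvg_snd.
exact: initial_continuous.
Qed.

Lemma jet_addr_continuous (w : J) : continuous (fun v : J => v + w).
Proof.
move=> v; apply: continuous_jet => [|i|i j].
- rewrite (_ : (fun z => _) = (fun z => jval z + jval w)) //.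
  by apply: continuousD; [exact: jval_continuous|exact: cst_continuous].
- rewrite (_ : (fun z => _) = (fun z => jdiff z 0 i + jdiff w 0 i)).
    by apply: continuousD; [exact: jdiff_continuous|exact: cst_continuous].
  by apply/funext => z; rewrite jdiffDi.
- rewrite (_ : (fun z => _) = (fun z => jhess z i j + jhess w i j)).
    by apply: continuousD; [exact: jhess_continuous|exact: cst_continuous].
  by apply/funext => z; rewrite jhessDi.
Qed.

End JetCoordinates.

(** Unification must not unfold partial derivatives into limits. *)
Opaque partial.

Section CoordinateJets.
Variables (R : realType) (n : nat).
Notation V := 'rV[R]_n.
Implicit Types (U W : set V) (f g : V -> R^o) (y z v : V) (i j : 'I_n).

Lemma jdiff_coord f y i : jdiff (coord_jet f y) 0 i = partial i f y.
Proof. by rewrite /jdiff /= mxE. Qed.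
Lemma jhess_coord f y i j : jhess (coord_jet f y) i j =
  2^-1 * (partial j (partial i f) y + partial i (partial j f) y).
Proof. by rewrite /jhess /= !mxE. Qed.

Lemma coord_jetP f y (v : jetfib R n) : f y = jval v ->
  (forall i, partial i f y = jdiff v 0 i) ->
  (forall i j, 2^-1 * (partial j (partial i f) y + partial i (partial j f) y) = jhess v i j) ->
  coord_jet f y = v.
Proof.
move=> h0 h1 h2; apply: jetP.
- by rewrite -h0.
- by apply/rowP => i; rewrite -h1 -jdiff_coord.
- by apply/matrixP => i j; rewrite -h2 -jhess_coord.
Qed.

Lemma coord_jet_near f g y : (\forall z \near y, f z = g z) ->
  coord_jet f y = coord_jet g y.
Proof.
(* Second derivatives at [y] see the first ones on a neighborhood, so the equality is first
   propagated to first derivatives near [y]. *)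
move=> fg; have E i : \forall z \near y, partial i f z = partial i g z.
  by have := near_join fg; apply: filterS => z; exact: partial_near.
apply: coord_jetP => [|i|i j]; first exact: nbhs_singleton fg.
  exact: etrans (partial_near i fg) (esym (jdiff_coord g y i)).
apply: etrans (esym (jhess_coord g y i j)).
exact: (congr1 _ (congr2 _ (partial_near j (E i)) (partial_near i (E j)))).
Qed.

Lemma C2_derivable U f y i : Ck_on 2 U f -> U y -> derivable f y (delta_mx 0 i).
Proof. by case=> _ /(_ i)[d _]; exact: d. Qed.

Lemma C2_partial U f i : Ck_on 2 U f -> Ck_on 1 U (partial i f).
Proof. by case=> _ /(_ i)[]. Qed.

Lemma C2_derivable2 U f y i j : Ck_on 2 U f -> U y ->
  derivable (partial i f) y (delta_mx 0 j).
Proof. by case=> _ /(_ i)[_ [_ /(_ j)[d _]]]; exact: d. Qed.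

Lemma coord_jet_add U f g y : open U -> Ck_on 2 U f -> Ck_on 2 U g -> U y ->
  coord_jet (f \+ g) y = coord_jet f y + coord_jet g y.
Proof.
move=> oU Hf Hg Uy.
have E i z : U z -> partial i (f \+ g) z = (partial i f \+ partial i g) z.
  by move=> Uz; apply: partialD; [exact: C2_derivable Hf Uz|exact: C2_derivable Hg Uz].
apply: coord_jetP => [|i|i j]; first by [].
  apply: etrans (E i y Uy) _; apply: esym; apply: etrans (jdiffDi _ _ i) _.
  exact: congr2 (jdiff_coord f y i) (jdiff_coord g y i).
apply: esym; apply: etrans (jhessDi _ _ i j) _.
apply: etrans (congr2 +%R (jhess_coord f y i j) (jhess_coord g y i j)) _.
apply: etrans (esym (mulrDr _ _ _)) _; apply: (congr1 ( *%R 2^-1)).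
have E2 k l : partial l (partial k (f \+ g)) y =
    partial l (partial k f) y + partial l (partial k g) y.
  apply: etrans (partial_near l (open_near_eq oU (E k) Uy)) _.
  by apply: partialD; [exact: C2_derivable2 Hf Uy|exact: C2_derivable2 Hg Uy].
apply: esym; apply: etrans (congr2 +%R (E2 i j) (E2 j i)) _.
exact: addrACA.
Qed.

Lemma coord_jet_scale U f (c : R) y : open U -> Ck_on 2 U f -> U y ->
  coord_jet (fun z => c * f z) y = c *: coord_jet f y.
Proof.
move=> oU Hf Uy.
have E i z : U z -> partial i (fun z => c * f z) z = c * partial i f z.
  by move=> Uz; apply: partialZ; exact: C2_derivable Hf Uz.
apply: coord_jetP => [|i|i j]; first by [].
  apply: etrans (E i y Uy) _; apply: esym; apply: etrans (jdiffZi _ _ i) _.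
  exact: (congr1 ( *%R c) (jdiff_coord f y i)).
apply: esym; apply: etrans (jhessZi _ _ i j) _.
apply: etrans (congr1 ( *%R c) (jhess_coord f y i j)) _.
apply: etrans (mulrCA _ _ _) _; apply: (congr1 ( *%R 2^-1)).
have E2 k l : partial l (partial k (fun z => c * f z)) y = c * partial l (partial k f) y.
  apply: etrans (partial_near l (open_near_eq oU (E k) Uy)) _.
  by apply: partialZ; exact: C2_derivable2 Hf Uy.
apply: etrans (mulrDr _ _ _) _.
exact: esym (congr2 +%R (E2 i j) (E2 j i)).
Qed.

Lemma coord_jet_cst (c : R) y : coord_jet (cst c) y = (c, 0, 0).
Proof.
apply: coord_jetP => [|i|i j]; first by [].
  by rewrite partial_cst [RHS]mxE.
by rewrite !partial_cst addr0 mulr0 [RHS]mxE.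
Qed.

Lemma quadraticE p (v : jetfib R n) : quadratic p v =
  fun z => (jval v + affine (jdiff v) p z) +
     2^-1 * \sum_j (affine (row j (jhess v)) p z * affine (delta_mx 0 j) p z).
Proof.
apply/funext => z; rewrite /quadratic; congr (_ + _ + _ * _).
  by rewrite mxE /affine /rowdot; apply: eq_bigr => i _; rewrite !mxE mulrC.
rewrite mxE; apply: eq_bigr => j _; rewrite /affine rowdot_deltal; congr (_ * _).
  by rewrite mxE; apply: eq_bigr => i _; rewrite !mxE jhess_sym.
by rewrite mxE.
Qed.

Lemma Ck_quadratic k U p (v : jetfib R n) : open U -> Ck_on k U (quadratic p v).
Proof.
move=> oU; rewrite quadraticE; apply: Ck_add => //.
  by apply: (@Ck_add R n k U (cst (jval v))) => //; [exact: Ck_cst|exact: Ck_affine].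
apply: Ck_scale => //; apply: Ck_sum => // j.
by apply: Ck_mul => //; exact: Ck_affine.
Qed.

Lemma partial_quadratic p (v : jetfib R n) i : partial i (quadratic p v) =
  fun z => jdiff v 0 i + affine (row i (jhess v)) p z.
Proof.
apply/funext => z; rewrite quadraticE.
set e := delta_mx 0 i : V.
have ha (a : V) := is_derive_affine a p z e.
have hs : is_derive z e (\sum_j (affine (row j (jhess v)) p * affine (delta_mx 0 j) p))
   (\sum_j (affine (row j (jhess v)) p z *: rowdot (delta_mx 0 j) e +
            affine (delta_mx 0 j) p z *: rowdot (row j (jhess v)) e)).
  by apply: is_derive_sum => j; apply: is_deriveM.
have hz := is_deriveZ 2^-1 hs.
have h0 := is_derive_cst (jval v : R^o) z e.
have h := is_deriveD (is_deriveD h0 (ha (jdiff v))) hz.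
have -> : (fun z => (jval v + affine (jdiff v) p z) +
     2^-1 * \sum_j (affine (row j (jhess v)) p z * affine (delta_mx 0 j) p z)) =
  cst (jval v) + affine (jdiff v) p + 2^-1 \*: (\sum_j (affine (row j (jhess v)) p * affine (delta_mx 0 j) p)).
  by apply/funext => t /=; rewrite [in RHS]/GRing.add /= fct_sumE.
rewrite (partial_val h) add0r rowdot_delta; congr (_ + _).
rewrite big_split /= (bigD1 i) //= big1 ?addr0; last first.
  by move=> j ji; rewrite rowdot_delta mxE eqxx eq_sym (negbTE ji) scaler0.
rewrite rowdot_delta mxE !eqxx /=.
(* By symmetry of the Hessian both halves of the Leibniz rule give the same sum, which absorbs the
   factor 1/2. *)
have -> : \sum_j affine (delta_mx 0 j) p z *: rowdot (row j (jhess v)) e =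
   affine (row i (jhess v)) p z.
  rewrite /affine [RHS]/rowdot; apply: eq_bigr => j _.
  by rewrite rowdot_deltal rowdot_delta !mxE jhess_sym.
rewrite [_ *: 1]mulr1 -[X in _ *: (X + X)]mul1r -mulrDl [_ *: _]mulrA.
by rewrite -[1 + 1]/(2%:R) mulVf ?mul1r // pnatr_eq0.
Qed.

Lemma coord_jet_quadratic p (v : jetfib R n) : coord_jet (quadratic p v) p = v.
Proof.
have a0 (a : V) : affine a p p = 0 by rewrite /affine subrr raddf0.
have P2 i j : partial j (partial i (quadratic p v)) p = jhess v i j.
  rewrite partial_quadratic.
  have h0 := is_derive_cst (jdiff v 0 i : R^o) p (delta_mx 0 j : V).
  have h := is_deriveD h0 (is_derive_affine (row i (jhess v)) p p (delta_mx 0 j)).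
  by rewrite [LHS](partial_val h) add0r rowdot_delta mxE.
apply: coord_jetP => [|i|i j].
- rewrite quadraticE /= a0 addr0 big1 ?mulr0 ?addr0 // => j _.
  by rewrite !a0 mulr0.
- by rewrite partial_quadratic a0 addr0.
- by rewrite !P2 [jhess v j i]jhess_sym; field.
Qed.

Lemma coord_jet_continuous U f y : open U -> Ck_on 2 U f -> U y ->
  {for y, continuous (coord_jet f)}.
Proof.
move=> oU Hf Uy; have c1 i : {for y, continuous (partial i f)}.
  exact: Ck_continuous (C2_partial i Hf) Uy.
have c2 i j : {for y, continuous (partial j (partial i f))}.
  by have [_ /(_ j)[_ h]] := C2_partial i Hf; exact: (@Ck_continuous R n 0 U _ y h Uy).
apply: continuous_jet => [|i|i j]; first exact: Ck_continuous Hf Uy.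
  by rewrite (_ : (fun z => _) = partial i f) //; apply/funext => z; rewrite jdiff_coord.
rewrite (_ : (fun z => _) = (fun z => 2^-1 * (partial j (partial i f) z + partial i (partial j f) z))).
  apply: continuousM; first exact: cst_continuous.
  by apply: continuousD; exact: c2.
by apply/funext => z; rewrite jhess_coord.
Qed.

End CoordinateJets.

(** * Change of coordinates and the maximum test *)

(** The algebra of the chain rule of order two, symmetrized in [i] and [k]: [D], [D2] stand for the
    derivatives of the change of coordinates, [a1], [a2] for those of the function. *)
Lemma second_order_chain (R : realType) n (D : 'I_n -> 'I_n -> R)
  (D2 : 'I_n -> 'I_n -> 'I_n -> R) (i k : 'I_n) (a1 : 'I_n -> R) (a2 : 'I_n -> 'I_n -> R) :
  \sum_j ((\sum_l a2 j l * D k l) * D i j + a1 j * D2 k i j) +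
  \sum_j ((\sum_l a2 j l * D i l) * D k j + a1 j * D2 i k j) =
  \sum_j (a1 j * (D2 k i j + D2 i k j)) + \sum_j \sum_l (a2 j l + a2 l j) * (D k l * D i j).
Proof.
rewrite !big_split /= addrACA addrC; congr (_ + _).
  by rewrite -big_split; apply: eq_bigr => j _; rewrite mulrDr.
have -> : \sum_j (\sum_l a2 j l * D i l) * D k j = \sum_j \sum_l a2 l j * (D k l * D i j).
  under eq_bigr do rewrite mulr_suml.
  rewrite exchange_big; apply: eq_bigr => l _; apply: eq_bigr => j _.
  by rewrite -mulrA [D i l * _]mulrC.
rewrite -big_split; apply: eq_bigr => j _; rewrite mulr_suml -big_split /=.
by apply: eq_bigr => l _; ring.
Qed.

Lemma quadform_sum (R : realType) n (A : 'M[R]_n) (w : 'rV[R]_n) :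
  (w *m A *m w^T) 0 0 = \sum_j \sum_i (w 0 i * A i j * w 0 j).
Proof. by rewrite mxE; apply: eq_bigr => j _; rewrite !mxE mulr_suml. Qed.

Section JetComposition.
Variables (R : realType) (n : nat).
Notation V := 'rV[R]_n.
Implicit Types (U W : set V) (f g : V -> R^o) (y z v w : V) (i j : 'I_n).
Variables (T : V -> V) (U W : set V).
Hypotheses (oU : open U) (oW : open W) (TUW : forall y, U y -> W (T y)).
Hypothesis C2T : forall j, Ck_on 2 U (fun z => T z 0 j).

Lemma partial2_comp f i k y : Ck_on 2 W f -> U y ->
  partial k (partial i (f \o T)) y =
  \sum_j ((\sum_l partial l (partial j f) (T y) * partial k (fun z => T z 0 l) y)
            * partial i (fun z => T z 0 j) y
          + partial j f (T y) * partial k (partial i (fun z => T z 0 j)) y).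
Proof.
move=> Hf Uy; have HT1 j : Ck_on 1 U (fun z => T z 0 j) by exact: CkS.
have E z : U z -> partial i (f \o T) z =
    (\sum_j ((partial j f \o T) * partial i (fun z => T z 0 j))) z.
  move=> Uz; rewrite fct_sumE; exact: (partial_comp oU oW TUW i HT1 (CkS Hf) Uz).2.
apply: etrans (partial_near k (open_near_eq oU E Uy)) _.
have h : is_derive y (delta_mx 0 k) (\sum_j ((partial j f \o T) * partial i (fun z => T z 0 j)))
   (\sum_j ((partial j f \o T) y *: partial k (partial i (fun z => T z 0 j)) y +
      partial i (fun z => T z 0 j) y *: partial k (partial j f \o T) y)).
  apply: is_derive_sum => j; apply: is_deriveM.
    have [d _] := partial_comp oU oW TUW k HT1 (C2_partial j Hf) Uy.
    exact: is_derive_partial d.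
  by apply: is_derive_partial; exact: C2_derivable2 (C2T j) Uy.
apply: etrans (partial_val h) _; apply: eq_bigr => j _.
have E1 := (partial_comp oU oW TUW k HT1 (C2_partial j Hf) Uy).2.
apply: etrans (addrC _ _) _; congr (_ + _).
exact: etrans (mulrC _ _) (congr1 (fun a => a * _) E1).
Qed.

(** Symmetry of second derivatives plays no role: the coefficients of the second
    derivatives of [f] in the chain rule are symmetric, so that only the
    symmetrized Hessian of [f] enters. *)
Lemma coord_jet_comp f g y : Ck_on 2 W f -> Ck_on 2 W g -> U y ->
  coord_jet f (T y) = coord_jet g (T y) ->
  coord_jet (f \o T) y = coord_jet (g \o T) y.
Proof.
move=> Hf Hg Uy E.
have HT1 j : Ck_on 1 U (fun z => T z 0 j) by exact: CkS.
have E0 : f (T y) = g (T y) by exact: (congr1 (@jval R n) E).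
have E1 i : partial i f (T y) = partial i g (T y).
  apply: etrans (esym (jdiff_coord f (T y) i)) _.
  exact: etrans (congr1 (fun u : jetfib R n => jdiff u 0 i) E) (jdiff_coord g (T y) i).
have E2 i j : partial j (partial i f) (T y) + partial i (partial j f) (T y) =
              partial j (partial i g) (T y) + partial i (partial j g) (T y).
  have h : 2^-1 * (partial j (partial i f) (T y) + partial i (partial j f) (T y)) =
           2^-1 * (partial j (partial i g) (T y) + partial i (partial j g) (T y)).
    apply: etrans (esym (jhess_coord f (T y) i j)) _.
    exact: etrans (congr1 (fun u : jetfib R n => jhess u i j) E) (jhess_coord g (T y) i j).
  by apply: (mulfI _ h); rewrite invr_eq0 pnatr_eq0.
apply: coord_jetP => [|i|i k].
- exact: E0.
- apply: etrans (partial_comp oU oW TUW i HT1 (CkS Hf) Uy).2 _.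
  apply: etrans (esym (jdiff_coord (g \o T) y i)).
  apply: etrans (esym (partial_comp oU oW TUW i HT1 (CkS Hg) Uy).2).
  by apply: eq_bigr => j _; exact: (congr1 (fun a => a * _) (E1 j)).
apply: etrans (esym (jhess_coord (g \o T) y i k)); apply: (congr1 ( *%R 2^-1)).
apply: etrans (congr2 +%R (partial2_comp i k Hf Uy) (partial2_comp k i Hf Uy)) _.
apply: etrans (esym (congr2 +%R (partial2_comp i k Hg Uy) (partial2_comp k i Hg Uy))).
pose D l j := partial l (fun z => T z 0 j) y.
pose D2 k i j := partial k (partial i (fun z => T z 0 j)) y.
have S := second_order_chain D D2 i k.
apply: etrans (S (fun j => partial j f (T y)) (fun j l => partial l (partial j f) (T y))) _.
apply: etrans (esym (S (fun j => partial j g (T y)) (fun j l => partial l (partial j g) (T y)))).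
apply: congr2.
  by apply: eq_bigr => j _; exact: (congr1 (fun a => a * _) (E1 j)).
apply: eq_bigr => j _; apply: eq_bigr => l _.
exact: (congr1 (fun a => a * _) (E2 j l)).
Qed.

End JetComposition.

(** * First and second derivative tests at a local maximum *)

Section MaximumTest.
Variables (R : realType) (n : nat).
Notation V := 'rV[R]_n.
Implicit Types (U W : set V) (f g : V -> R^o) (y z v w : V) (i j : 'I_n).

Lemma line_continuous y w : continuous (fun t : R => t *: w + y).
Proof.
by move=> t; apply: cvgD; [exact: scalel_continuous|exact: cvg_cst].
Qed.

Lemma near_line U y w : open U -> U y -> \forall t \near (0 : R), U (t *: w + y).
Proof.
move=> oU Uy; have := @line_continuous y w 0; rewrite /continuous_at scale0r add0r.
by apply; exact: open_nbhs_nbhs.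
Qed.

Lemma max_partial U f y i : open U -> Ck_on 1 U f -> U y ->
  (\forall z \near y, f z <= f y) -> partial i f y = 0.
Proof.
move=> oU [_ Hf] Uy fmax; have [d _] := Hf i.
set e := delta_mx 0 i : V.
have cl := @line_continuous y e 0.
have : \forall t \near (0 : R), U (t *: e + y) /\ f (t *: e + y) <= f y.
  apply: filterI; first exact: near_line.
  by move: cl; rewrite /continuous_at scale0r add0r => cl; exact: (cl _ fmax).
case/nbhs_ballP => r /= r0 H.
have dg t : U (t *: e + y) -> is_derive t (1 : R) (fun t => f (t *: e + y)) (partial i f (t *: e + y)).
  by move=> Ut; apply: is_derive_line; exact: d.
have B t : t \in `]- r, r[%R -> ball 0 r t.
  by rewrite in_itv /= -ltr_norml -ball_normE /= sub0r normrN.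
have [| | | |_ D] := @derive1_at_max R (fun t => f (t *: e + y)) (- r) r 0.
- by rewrite ge0_cp // ltW.
- by move=> t /B/H[/dg[]].
- by rewrite in_itv /= oppr_lt0 r0.
- by move=> t /B/H[]; rewrite scale0r add0r.
have [|_] := dg 0; first by rewrite scale0r add0r.
by rewrite D scale0r add0r.
Qed.

(** [G] is the derivative of [f] in the direction [w]: it vanishes at [y], and its own derivative
    along [w] there is the Hessian form. Were that positive, [G] would be positive just beyond [y]
    on the ray along [w], and the mean value theorem would make [f] exceed [f y] there. *)
Lemma max_hessian U f y w : open U -> Ck_on 2 U f -> U y ->
  (\forall z \near y, f z <= f y) ->
  (w *m jhess (coord_jet f y) *m w^T) 0 0 <= 0.
Proof.
move=> oU Hf Uy fmax.
pose G : V -> R^o := fun z => \sum_i w 0 i * partial i f z.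
have CG : Ck_on 1 U G.
  by apply: Ck_sum => // i; apply: Ck_scale => //; exact: C2_partial.
have DG : 'D_w G y = (w *m jhess (coord_jet f y) *m w^T) 0 0.
  pose A i j := w 0 i * w 0 j * partial j (partial i f) y.
  have -> : 'D_w G y = \sum_j \sum_i A i j.
    rewrite (derive_C1 w oU CG Uy) /rowdot; apply: eq_bigr => j _; rewrite mxE.
    have h : is_derive y (delta_mx 0 j) (\sum_i (w 0 i \*: partial i f))
       (\sum_i w 0 i *: partial j (partial i f) y).
      apply: is_derive_sum => i; apply: is_deriveZ.
      by apply: is_derive_partial; exact: C2_derivable2 Hf Uy.
    have GE : G = \sum_i (w 0 i \*: partial i f) by apply/funext => z; rewrite fct_sumE.
    rewrite GE (partial_val h) mulr_sumr; apply: eq_bigr => i _.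
    by rewrite /A mulrA; congr (_ * _); rewrite mulrC.
  apply: etrans (esym (quadform_sum _ w)).
  (* The jet stores the symmetrized Hessian, but a quadratic form sees only the symmetric part. *)
  transitivity (\sum_j \sum_i (2^-1 * (A i j + A j i))).
    transitivity (2^-1 * (\sum_j \sum_i A i j + \sum_j \sum_i A j i)).
      by rewrite [X in _ + X]exchange_big /=; field.
    rewrite -big_split mulr_sumr; apply: eq_bigr => j _.
    by rewrite -big_split mulr_sumr.
  apply: eq_bigr => j _; apply: eq_bigr => i _.
  apply: etrans (esym (congr1 (fun a => w 0 i * a * w 0 j) (jhess_coord f y i j))).
  by rewrite /A; move: (partial j _ y) (partial i _ y) => a b; ring.
rewrite -DG leNgt; apply/negP => s0.
set s := 'D_w G y in s0.
have G0 : G y = 0.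
  rewrite /G big1 // => i _; rewrite (max_partial i oU (CkS Hf) Uy fmax) mulr0 //.
have dG : derivable G y w.
  by apply: diff_derivable; exact: (C1_differentiable oU CG Uy).1.
have : \forall t \near 0^', 0 < t^-1 *: ((G \o shift y) (t *: w) - G y).
  by have := @cvgr_gt _ _ _ _ _ _ dG; apply.
rewrite near_withinE => H.
have : \forall t \near (0 : R), [/\ t != 0 -> 0 < t^-1 *: ((G \o shift y) (t *: w) - G y),
   U (t *: w + y) & f (t *: w + y) <= f y].
  near=> t; split; [by near: t|near: t; exact: near_line|near: t].
  by have := @line_continuous y w 0; rewrite /continuous_at scale0r add0r => cl; exact: (cl _ fmax).
case/nbhs_ballP => r /= r0 K.
pose t := r / 2; have t0 : 0 < t by rewrite divr_gt0.
have tr : t < r by rewrite ltr_pdivrMr // mulr2n mulrDr mulr1 ltrDl.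
have B c : 0 <= c -> c <= t -> ball 0 r c.
  by move=> c0 ct; rewrite -ball_normE /= sub0r normrN ger0_norm // (le_lt_trans ct).
pose g (c : R) := f (c *: w + y) : R.
have dg c : 0 <= c -> c <= t -> is_derive c (1 : R) g (G (c *: w + y)).
  move=> c0 ct; have [_ Uc _] := K c (B c c0 ct).
  rewrite (_ : G _ = 'D_w f (c *: w + y)).
    apply: is_derive_line; apply: diff_derivable.
    exact: (C1_differentiable oU (CkS Hf) Uc).1.
  rewrite (derive_C1 w oU (CkS Hf) Uc) /rowdot; apply: eq_bigr => i _.
  by rewrite mxE.
have [| |c] := @MVT R g (fun c => G (c *: w + y)) 0 t t0.
- by move=> c; rewrite in_itv /= => /andP[c0 ct]; apply: dg; exact: ltW.
- apply: continuous_in_subspaceT => c; rewrite inE /= in_itv /= => /andP[c0 ct].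
  have d := dg c c0 ct.
  by apply: differentiable_continuous; exact/derivable1_diffP.
rewrite in_itv /= subr0 => /andP[c0 ct] gE.
have [+ _ _] := K c (B c (ltW c0) (ltW ct)).
rewrite gt_eqF // => /(_ isT); rewrite G0 subr0 /= pmulr_rgt0 ?invr_gt0 // => Gc.
have [_ _] := K t (B t (ltW t0) (lexx t)).
rewrite leNgt => /negP; apply.
have -> : f y = g 0 by rewrite /g scale0r add0r.
by rewrite -subr_gt0 -/(g t) gE mulr_gt0.
Unshelve. all: by end_near. Qed.

End MaximumTest.

(** * Jets of functions on a manifold *)

Section JetMaps.
Variables (R : realType) (n : nat) (T : topologicalType).

Lemma continuous_jet_entries (J : T -> jetfib R n) x : {for x, continuous J} ->
  [/\ {for x, continuous (fun z => jval (J z) : R)},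
      forall i, {for x, continuous (fun z => jdiff (J z) 0 i)} &
      forall i j, {for x, continuous (fun z => jhess (J z) i j)}].
Proof.
move=> c; split=> [|i|i j].
- exact: (@continuous_comp _ _ _ J (fun v => jval v : R) x c (@jval_continuous R n _)).
- exact: (@continuous_comp _ _ _ J (fun v => jdiff v 0 i) x c (@jdiff_continuous R n i _)).
- exact: (@continuous_comp _ _ _ J (fun v => jhess v i j) x c (@jhess_continuous R n i j _)).
Qed.

Lemma continuous_jetD (J1 J2 : T -> jetfib R n) x :
  {for x, continuous J1} -> {for x, continuous J2} -> {for x, continuous (fun z => J1 z + J2 z)}.
Proof.
move=> /continuous_jet_entries[a0 a1 a2] /continuous_jet_entries[b0 b1 b2].
apply: continuous_jet => [|i|i j].
- exact: (continuousD a0 b0).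
- rewrite (_ : (fun z => _) = (fun z => jdiff (J1 z) 0 i + jdiff (J2 z) 0 i)).
    exact: (continuousD (a1 i) (b1 i)).
  by apply/funext => z; rewrite jdiffDi.
- rewrite (_ : (fun z => _) = (fun z => jhess (J1 z) i j + jhess (J2 z) i j)).
    exact: (continuousD (a2 i j) (b2 i j)).
  by apply/funext => z; rewrite jhessDi.
Qed.

Lemma continuous_jetZ (e : T -> R) (J : T -> jetfib R n) x :
  {for x, continuous e} -> {for x, continuous J} -> {for x, continuous (fun z => e z *: J z)}.
Proof.
move=> ce /continuous_jet_entries[a0 a1 a2]; apply: continuous_jet => [|i|i j].
- exact: (continuousM ce a0).
- rewrite (_ : (fun z => _) = (fun z => e z * jdiff (J z) 0 i)).
    exact: (continuousM ce (a1 i)).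
  by apply/funext => z; rewrite jdiffZi.
- rewrite (_ : (fun z => _) = (fun z => e z * jhess (J z) i j)).
    exact: (continuousM ce (a2 i j)).
  by apply/funext => z; rewrite jhessZi.
Qed.

Lemma continuous_jet_cst (k : T -> R) x :
  {for x, continuous k} -> {for x, continuous (fun z => (k z, 0, 0) : jetfib R n)}.
Proof.
move=> ck; apply: continuous_jet => [|i|i j]; first exact: ck.
  exact: cst_continuous.
exact: cst_continuous.
Qed.

End JetMaps.

Section Charts.
Variables (R : realType) (n : nat) (X : manifold R n).
Notation V := 'rV[R]_n.
Implicit Types (c : chart R n X) (x y z : X) (B : set X) (f g : X -> R).

Lemma crange_cmap c x : cdom c x -> crange c (cmap c x).
Proof. by exists x. Qed.

Lemma crangeP c p : crange c p -> cdom c (cinv c p) /\ cmap c (cinv c p) = p.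
Proof. by case=> x dx <-; rewrite cmapK. Qed.

Lemma near_cdom c x : cdom c x -> \forall z \near x, cdom c z.
Proof. by move=> dx; exact: open_nbhs_nbhs (conj (cdom_open c) dx). Qed.

Lemma near_cmap c x (Q : V -> Prop) : cdom c x ->
  (\forall p \near cmap c x, Q p) -> \forall z \near x, Q (cmap c z).
Proof. by move=> dx HQ; exact: (cmap_continuous dx HQ). Qed.

Lemma near_cinv c x (P : X -> Prop) : cdom c x ->
  (\forall z \near x, P z) -> \forall p \near cmap c x, P (cinv c p).
Proof.
move=> dx HP; have := cinv_continuous (crange_cmap dx).
by rewrite /prop_for /continuous_at (cmapK dx) => h; exact: (h _ HP).
Qed.

Lemma near_crange c x : cdom c x -> \forall p \near cmap c x, crange c p.
Proof.
move=> dx; have : nbhs (cmap c x) (crange c).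
  by apply: open_nbhs_nbhs; split; [exact: crange_open|exact: crange_cmap].
exact: filterS.
Qed.

Lemma chart_image_open c B : open B -> open (cmap c @` (B `&` cdom c)).
Proof.
move=> oB; rewrite openE => _ [x [Bx dx] <-]; rewrite /interior.
have := near_cinv dx (open_nbhs_nbhs (conj oB Bx)).
apply: filterS2 (near_crange dx) => p /crangeP[dp E] Bp.
by exists (cinv c p).
Qed.

Lemma overlapE c c' B : B `<=` cdom c -> cmap c' @` (B `&` cdom c') `<=` overlap c' c.
Proof. by move=> Bc _ [x [Bx dx] <-]; exists x => //; split=> //; exact: Bc. Qed.

Lemma transition_continuous c c' p : overlap c c' p -> {for p, continuous (transition c c')}.
Proof.
case=> x [dx dx'] <-; apply: continuous_comp; first exact: cinv_continuous (crange_cmap dx).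
by rewrite (cmapK dx); exact: cmap_continuous.
Qed.

Lemma transition_Ck c c' (U : set V) k i : atlas c -> atlas c' -> U `<=` overlap c c' ->
  Ck_on k U (fun p => transition c c' p 0 i).
Proof. by move=> ac ac' Uo; apply: Ck_sub Uo _; exact: transition_smooth. Qed.

(** In another chart the function reads as [h] composed with a smooth transition map. *)
Lemma Ck_fun_chart k c (h : V -> R^o) : atlas c -> Ck_on k setT h ->
  Ck_fun_on k (cdom c) (h \o cmap c).
Proof.
move=> ac Hh c' ac'; pose U := cmap c' @` (cdom c `&` cdom c').
have oU : open U by apply: chart_image_open; exact: cdom_open.
have Uo : U `<=` overlap c' c by apply: overlapE.
have cT p : U p -> {for p, continuous (transition c' c)}.
  by move=> /Uo; exact: transition_continuous.
have HT j : Ck_on k U (fun p => transition c' c p 0 j) by exact: transition_Ck.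
exact: (@Ck_comp R n (transition c' c) U setT oU openT (fun _ _ => I) cT k h HT Hh).
Qed.

Lemma Ck_fun_sub k B B' f : B' `<=` B -> Ck_fun_on k B f -> Ck_fun_on k B' f.
Proof.
move=> BB Hf c ac; apply: Ck_sub (Hf c ac).
by apply: image_subset => x [Bx dx]; split=> //; exact: BB.
Qed.

Lemma Ck_fun_cst k B (r : R) : Ck_fun_on k B (cst r).
Proof. by move=> c ac; exact: Ck_cst. Qed.

Lemma Ck_fun_add k B f g : open B -> Ck_fun_on k B f -> Ck_fun_on k B g ->
  Ck_fun_on k B (f \+ g).
Proof.
move=> oB Hf Hg c ac; apply: (@Ck_add R n k _ (f \o cinv c) (g \o cinv c)).
- exact: chart_image_open.
- exact: Hf.
- exact: Hg.
Qed.

Lemma Ck_fun_scale k B f (r : R) : open B -> Ck_fun_on k B f ->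
  Ck_fun_on k B (fun x => r * f x).
Proof.
move=> oB Hf c ac; apply: (@Ck_scale R n k _ (f \o cinv c) r).
  exact: chart_image_open.
exact: Hf.
Qed.

Lemma C2_nearI B f x : open B -> B x -> Ck_fun_on 2 B f -> C2_near x f.
Proof. by move=> oB Bx Hf; exists B. Qed.

Lemma C2_near_near f x : C2_near x f -> \forall z \near x, C2_near z f.
Proof.
case=> B [oB Bx Hf]; apply: filterS (open_nbhs_nbhs (conj oB Bx)) => z Bz.
exact: (C2_nearI oB Bz Hf).
Qed.

Lemma C2_near_add f g x : C2_near x f -> C2_near x g -> C2_near x (f \+ g).
Proof.
case=> B [oB Bx Hf] [B' [oB' Bx' Hg]]; apply: (@C2_nearI (B `&` B')); [exact: openI|by split|].
apply: Ck_fun_add; first exact: openI.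
  by apply: Ck_fun_sub Hf => z [].
by apply: Ck_fun_sub Hg => z [].
Qed.

Lemma C2_near_cst (r : R) x : C2_near x (cst r).
Proof. exact: (C2_nearI openT I (@Ck_fun_cst 2 setT r)). Qed.

Lemma C2_near_scale f (r : R) x : C2_near x f -> C2_near x (fun z => r * f z).
Proof. by case=> B [oB Bx Hf]; apply: (C2_nearI oB Bx); exact: Ck_fun_scale. Qed.

Lemma C2_near_chart f x : C2_near x f -> exists U : set V,
  [/\ open U, U (cmap (chart_at x) x) & Ck_on 2 U (f \o cinv (chart_at x))].
Proof.
case=> B [oB Bx Hf]; exists (cmap (chart_at x) @` (B `&` cdom (chart_at x))); split.
- exact: chart_image_open.
- by exists x => //; split=> //; exact: chart_at_dom.
- exact: Hf (chart_at_atlas x).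
Qed.

Lemma C2_near_continuous f x : C2_near x f -> {for x, continuous (f : X -> R^o)}.
Proof.
move=> /C2_near_chart[U [oU Ux Hf]].
have dx := chart_at_dom x.
have c : {for x, continuous ((f \o cinv (chart_at x)) \o cmap (chart_at x))}.
  apply: continuous_comp; first exact: cmap_continuous.
  exact: Ck_continuous Hf Ux.
apply: continuous_near_eq c; apply: filterS (near_cdom dx) => z dz.
by rewrite /= cmapK.
Qed.

Lemma jet_at_add f g x : C2_near x f -> C2_near x g ->
  jet_at x (f \+ g) = jet_at x f + jet_at x g.
Proof.
move=> /C2_near_chart[U [oU Ux Hf]] /C2_near_chart[U' [oU' Ux' Hg]].
apply: (@coord_jet_add R n (U `&` U') (f \o cinv (chart_at x)) (g \o cinv (chart_at x))).
- exact: openI.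
- by apply: Ck_sub Hf => z [].
- by apply: Ck_sub Hg => z [].
- by [].
Qed.

Lemma jet_at_scale f (r : R) x : C2_near x f ->
  jet_at x (fun z => r * f z) = r *: jet_at x f.
Proof.
move=> /C2_near_chart[U [oU Ux Hf]].
exact: (@coord_jet_scale R n U (f \o cinv (chart_at x)) r _ oU Hf Ux).
Qed.

Lemma jet_at_cst (r : R) x : jet_at x (cst r) = (r, 0, 0).
Proof. exact: coord_jet_cst. Qed.

(** Chart independence of jets. The quadratic polynomial with the 2-jet of [f] in [c] also has the
    2-jet of [f] in [chart_at x], by [coord_jet_comp] for the transition map. This links jets, read
    in the chart at their base point, to the topology of the total space, read in any chart. *)
Lemma jet_at_chart c f x : atlas c -> cdom c x -> C2_near x f ->
  chart_jet c (cmap c x) (coord_jet (f \o cinv c) (cmap c x)) = Jet x (jet_at x f).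
Proof.
move=> ac dx [B [oB Bx Hf]].
set v := coord_jet _ _; rewrite /chart_jet (cmapK dx); apply: congr1.
pose c' := chart_at x; have ac' : atlas c' := chart_at_atlas x.
have dx' : cdom c' x := chart_at_dom x.
pose U := cmap c' @` (B `&` cdom c `&` cdom c').
have oU : open U by apply: chart_image_open; apply: openI => //; exact: cdom_open.
have Uo : U `<=` overlap c' c by apply: overlapE => z [].
pose W := cmap c @` (B `&` cdom c).
have oW : open W by exact: chart_image_open.
pose T := transition c' c.
have TUW p : U p -> W (T p).
  by case=> z [[Bz dz] dz'] <-; rewrite /T /transition /= cmapK //; exists z.
have HT j : Ck_on 2 U (fun p => T p 0 j) by exact: transition_Ck.
have Ux : U (cmap c' x) by exists x.
have Tx : T (cmap c' x) = cmap c x by rewrite /T /transition /= cmapK.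
have HW : Ck_on 2 W (f \o cinv c) by exact: Hf.
have Hq : Ck_on 2 W (quadratic (cmap c x) v) by exact: Ck_quadratic.
have E : coord_jet (quadratic (cmap c x) v) (T (cmap c' x)) =
         coord_jet (f \o cinv c) (T (cmap c' x)).
  by rewrite Tx; exact: coord_jet_quadratic.
have H := coord_jet_comp oU oW TUW HT Hq HW Ux E.
transitivity (coord_jet ((f \o cinv c) \o T) (cmap c' x)); first exact: H.
apply: coord_jet_near; apply: filterS (open_nbhs_nbhs (conj oU Ux)) => p.
by case=> z [[Bz dz] dz'] <-; rewrite /= /T /transition /= !cmapK.
Qed.

(** Euclidean distance, for smoothness: the norm of row vectors is the sup norm. *)
Definition sqdist (p : V) : V -> R^o :=
  fun q => \sum_j affine (delta_mx 0 j) p q * affine (delta_mx 0 j) p q.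

Lemma sqdistE p q : sqdist p q = \sum_j (q 0 j - p 0 j) ^+ 2.
Proof.
by apply: eq_bigr => j _; rewrite /affine rowdot_deltal !mxE expr2.
Qed.

Lemma Ck_sqdist k U p : open U -> Ck_on k U (sqdist p).
Proof.
by move=> oU; apply: Ck_sum => // j; apply: Ck_mul => //; exact: Ck_affine.
Qed.

(** Squared coordinate distance to [x]; meaningless outside the chart at [x]. *)
Definition bump x : X -> R := sqdist (cmap (chart_at x) x) \o cmap (chart_at x).

Lemma bump_ge0 x z : 0 <= bump x z.
Proof. by rewrite /bump /= sqdistE sumr_ge0 // => j _; exact: sqr_ge0. Qed.

Lemma bump0 x : bump x x = 0.
Proof. by rewrite /bump /= sqdistE big1 // => j _; rewrite subrr expr0n. Qed.

Lemma Ck_fun_bump k x : Ck_fun_on k (cdom (chart_at x)) (bump x).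
Proof.
apply: Ck_fun_chart; first exact: chart_at_atlas.
by apply: Ck_sqdist; exact: openT.
Qed.

Lemma C2_near_bump x z : cdom (chart_at x) z -> C2_near z (bump x).
Proof. move=> dz; exact: (C2_nearI (cdom_open _) dz (@Ck_fun_bump 2 x)). Qed.

(** The term in [e] separates graphs away from [x]; the constant [k] adjusts the value, to restore a
    contact or to reach a prescribed value. *)
Definition perturb x f (e k : R) : X -> R := (f \+ (fun z => e * bump x z)) \+ cst k.

Lemma C2_near_perturb x f (e k : R) z : cdom (chart_at x) z -> C2_near z f ->
  C2_near z (perturb x f e k).
Proof.
move=> dz Hf; apply: C2_near_add; last exact: C2_near_cst.
by apply: C2_near_add; [exact: Hf|apply: C2_near_scale; exact: C2_near_bump].
Qed.

(** Small perturbations of the 2-jet of [f], taken at nearby points, stay in any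
    open set of jets that contains the jet of [f] at [x]. *)
Lemma jet_stable x f (W : set (jet2 X)) : C2_near x f -> open W -> W (Jet x (jet_at x f)) ->
  exists2 d : R, 0 < d & \forall z \near x, forall e k, `|e| < d -> `|k| < d ->
    C2_near z (perturb x f e k) /\ W (Jet z (jet_at z (perturb x f e k))).
Proof.
move=> Hf oW Wx; pose c := chart_at x; pose p := cmap c x.
have ac : atlas c := chart_at_atlas x; have dx : cdom c x := chart_at_dom x.
have oO : open [set q : V * jetfib R n | crange c q.1 /\ W (chart_jet c q.1 q.2)] := oW c ac.
have [B [oB Bx HB]] := Hf.
pose U := cmap c @` (B `&` cdom c).
have oU : open U by exact: chart_image_open.
have Up : U p by exists x.
pose f0 := f \o cinv c : V -> R^o.
have Hf0 : Ck_on 2 U f0 by exact: HB.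
have Hs : Ck_on 2 U (sqdist p) by exact: Ck_sqdist.
(* The jet in the chart at [x] of the perturbation with coefficients [t.2], at the point [t.1]. Its
   joint continuity yields a neighborhood of [x] and a bound on the coefficients independent of each
   other. *)
pose Phi (t : V * (R * R)) : jetfib R n :=
  (coord_jet f0 t.1 + t.2.1 *: coord_jet (sqdist p) t.1) + (t.2.2, 0, 0).
pose o : V * (R * R) := (p, (0, 0)).
have c1 : {for o, continuous (fst : V * (R * R) -> V)} by exact: cvg_fst.
have c2 : {for o, continuous (snd : V * (R * R) -> R * R)} by exact: cvg_snd.
have c21 : {for o, continuous (fun t : V * (R * R) => t.2.1)}.
  by apply: (@continuous_comp _ _ _ snd fst o c2); exact: cvg_fst.
have c22 : {for o, continuous (fun t : V * (R * R) => t.2.2)}.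
  by apply: (@continuous_comp _ _ _ snd snd o c2); exact: cvg_snd.
have cPhi : {for o, continuous Phi}.
  apply: continuous_jetD; last exact: continuous_jet_cst.
  apply: continuous_jetD.
    by apply: (@continuous_comp _ _ _ fst (coord_jet f0) o c1); exact: coord_jet_continuous Hf0 Up.
  apply: continuous_jetZ; first exact: c21.
  by apply: (@continuous_comp _ _ _ fst (coord_jet (sqdist p)) o c1); exact: coord_jet_continuous Hs Up.
have Phio : Phi o = coord_jet f0 p.
  rewrite /Phi /o /= scale0r addr0.
  by apply: jetP; [exact: addr0|exact: addr0|exact: addr0].
set O := [set q | _] in oO.
have nOP : nbhs (p, Phi o) O.
  apply: open_nbhs_nbhs; split; first exact: oO.
  split; first exact: crange_cmap.
  rewrite /= Phio; apply: (eq_ind_r W Wx); exact: jet_at_chart.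
have cP : {for o, continuous (fun t => (t.1, Phi t))} by exact: (cvg_pair c1 cPhi).
have nO := cP O nOP.
case: nO => -[/= A A'] [nA [/= [A1 A2] [nA1 nA2] A12]] AA.
have [r1 /= r10 H1] : nbhs_ball (0 : R) A1 by apply/nbhs_ballP.
have [r2 /= r20 H2] : nbhs_ball (0 : R) A2 by apply/nbhs_ballP.
exists (Num.min r1 r2); first by rewrite lt_min r10.
have nB := near_cmap dx nA.
near=> z => e k; rewrite !lt_min => /andP[e1 e2] /andP[k1 k2].
have dz : cdom c z by near: z; exact: near_cdom.
have Bz : B z by near: z; exact: open_nbhs_nbhs.
have Az : A (cmap c z) by near: z; exact: nB.
have Hfz : C2_near z f := C2_nearI oB Bz HB.
have Hz := C2_near_perturb e k dz Hfz; split; first exact: Hz.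
have b1 : A1 e by apply: H1; rewrite -ball_normE /= sub0r normrN.
have b2 : A2 k by apply: H2; rewrite -ball_normE /= sub0r normrN.
have [_] := AA (cmap c z, (e, k)) (conj Az (A12 (e, k) (conj b1 b2))).
have Uz : U (cmap c z) by exists z.
rewrite /Phi /= => WP.
have -> : Jet z (jet_at z (perturb x f e k)) = chart_jet c (cmap c z)
   (coord_jet f0 (cmap c z) + e *: coord_jet (sqdist p) (cmap c z) + (k, 0, 0)).
  apply: etrans (esym (jet_at_chart ac dz Hz)) _; congr (chart_jet c _ _).
  have Hes : Ck_on 2 U (fun q => e * sqdist p q) by exact: Ck_scale.
  have Hfes : Ck_on 2 U (f0 \+ (fun q => e * sqdist p q)) by exact: Ck_add.
  have E1 := coord_jet_add oU Hfes (Ck_cst 2 U k) Uz.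
  have E2 := coord_jet_add oU Hf0 Hes Uz.
  have E3 := coord_jet_scale e oU Hs Uz.
  transitivity (coord_jet ((f0 \+ (fun q => e * sqdist p q)) \+ cst k) (cmap c z)).
    apply: coord_jet_near; apply: filterS (near_crange dz) => q /crangeP[dq Eq].
    by rewrite /perturb /bump /f0 /= Eq.
  apply: etrans E1 _; apply: congr2; last exact: coord_jet_cst.
  by apply: etrans E2 _; congr (_ + _).
exact: WP.
Unshelve. all: by end_near. Qed.

End Charts.

(** * Upper semicontinuous functions *)

Section Semicontinuity.
Variable (R : realType).
Local Open Scope ereal_scope.

Lemma ereal_between (a b : \bar R) : a < b -> exists r : R, a < r%:E /\ r%:E < b.
Proof.
case: a b => [a| |] [b| |] //.
- rewrite lte_fin => ab; exists ((a + b) / 2)%R.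
  by rewrite !lte_fin; split; lra.
- by move=> _; exists (a + 1)%R; rewrite lte_fin ltrDl ltr01 ltry.
- by move=> _; exists (b - 1)%R; rewrite lte_fin ltrBlDr ltrDl ltr01 ltNyr.
- by move=> _; exists 0%R; rewrite ltNyr ltry.
Qed.

Section Manifold.
Variables (n : nat) (X : manifold R n).
Implicit Types (x y z : X) (u : X -> \bar R) (K : set X) (f g : X -> R).

Lemma usc_on_sub K K' u : K' `<=` K -> usc_on K u -> usc_on K' u.
Proof.
move=> KK' uK x /KK' /uK[ux Hx]; split=> // a /Hx; rewrite !near_withinE.
by apply: filterS => z Hz /KK'.
Qed.

(** If the supremum [s] were not attained, each point would have a neighborhood on which [u] stays
    below some number less than [s]; compactness would make this bound uniform. *)
Lemma usc_max K u : compact K -> K !=set0 -> usc_on K u ->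
  exists2 y, K y & forall z, K z -> u z <= u y.
Proof.
move=> cK [x0 Kx0] uK.
have [[y [Ky uy]]|no] := pselect (exists y, K y /\ u y = ereal_sup [set u z | z in K]).
  by exists y => // z Kz; rewrite uy; apply: ereal_sup_ubound; exists z.
set s := ereal_sup _ in no; exfalso.
have us y : K y -> u y < s.
  move=> Ky; rewrite lt_neqAle; apply/andP; split.
    by apply/eqP => E; apply: no; exists y.
  by apply: ereal_sup_ubound; exists y.
(* A property holds along [Fi] if it holds from some bound [b < s] upwards; covering compactness
   along [Fi] thus produces a uniform bound. *)
pose Fi : set_system (\bar R) := [set S | exists2 b, b < s & forall a, b <= a -> S a].
have FFi : Filter Fi.
  split=> [|P Q [b1 b1s H1] [b2 b2s H2]|P Q PQ [b bs H]].
  - by exists (u x0); [exact: us|].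
  - exists (maxe b1 b2); first by rewrite gt_max b1s b2s.
    by move=> a; rewrite ge_max => /andP[/H1 ? /H2 ?].
  - by exists b => // a /H /PQ.
have /compact_near_coveringP/near_covering_withinP := cK.
move=> /(_ _ Fi (fun a z => u z < a) FFi)[].
  move=> x Kx; have [r [r1 r2]] := ereal_between (us x Kx).
  have [_ /(_ _ r1) Hr] := uK x Kx; rewrite near_withinE in Hr.
  exists ([set z | K z -> u z < r%:E], [set a | r%:E <= a]).
    by split=> //=; exists r%:E.
  by move=> [z a] /= [h ra] /h /lt_le_trans; apply.
move=> b bs /(_ b (lexx b)) H.
have : s <= b.
  by apply: ge_ereal_sup => _ [z Kz <-]; apply/ltW/H.
by rewrite leNgt bs.
Qed.

Lemma near_gt_continuous f x (a : R) : {for x, continuous (f : X -> R^o)} -> (a < f x)%R ->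
  \forall z \near x, (a < f z)%R.
Proof. by move=> cf af; exact: (cvgr_gt _ cf). Qed.

Lemma near_lt_continuous f x (a : R) : {for x, continuous (f : X -> R^o)} -> (f x < a)%R ->
  \forall z \near x, (f z < a)%R.
Proof. by move=> cf af; exact: (cvgr_lt _ cf). Qed.

Lemma usc_on_subr K u f : usc_on K u -> (forall x, K x -> {for x, continuous (f : X -> R^o)}) ->
  usc_on K (fun z => u z - (f z)%:E).
Proof.
move=> uK cf x Kx; have [ux Hx] := uK x Kx; split.
  by rewrite lteBlDr // addye // ltry in ux *; case: (u x) ux.
move=> a; rewrite lteBlDr // -EFinD => /ereal_between[b [ub]].
rewrite lte_fin => bf.
have bf' : (b - a < f x)%R by rewrite ltrBlDr addrC.
have := Hx b ub; rewrite !near_withinE.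
apply: filterS2 (near_gt_continuous (cf x Kx) bf') => z bz Hz /Hz uz; rewrite lteBlDr // -EFinD (lt_trans uz) // lte_fin.
by rewrite -ltrBlDl.
Qed.

(** The upper semicontinuous regularization of [u] along [K]. *)
Definition usr K u : X -> \bar R := fun x =>
  ereal_inf [set a%:E | a in [set a : R | \forall z \near x, K z -> u z <= a%:E]].

Lemma usr_le K u x (a : R) : (\forall z \near x, K z -> u z <= a%:E) -> usr K u x <= a%:E.
Proof. by move=> H; apply: ereal_inf_lbound; exists a. Qed.

Lemma usr_ltP K u x (b : \bar R) : usr K u x < b ->
  exists a : R, a%:E < b /\ \forall z \near x, K z -> u z <= a%:E.
Proof. by move=> /ereal_inf_lt[_ [a Ha <-] ab]; exists a. Qed.

Lemma usr_ge K u x : K x -> u x <= usr K u x.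
Proof.
move=> Kx; apply: le_ereal_inf_tmp => _ [a /= Ha <-].
exact: (nbhs_singleton Ha).
Qed.

Lemma usr_usc K u : (forall x, K x -> usr K u x < +oo) -> usc_on K (usr K u).
Proof.
move=> H x Kx; split; first exact: H.
move=> a /usr_ltP[b [ba Hb]]; rewrite near_withinE.
have := near_join Hb; apply: filterS => z Hz _.
by apply: le_lt_trans ba; exact: usr_le.
Qed.

(** Contact is expressed without differences of extended reals, so that infinite values of [u] need
    no separate care. *)
Lemma subharmonicP (F : set (jet2 X)) (Y : set X) u : subharmonic F Y u <->
  usc_on Y u /\ forall x (phi : X -> R), Y x -> C2_near x phi ->
    (\forall z \near x, u z <= (phi z)%:E) -> u x = (phi x)%:E ->
    F (Jet x (jet_at x phi)).
Proof.
split=> -[uY H]; split=> // x phi Yx Hp le e; apply: H => //.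
- by apply: filterS le => z; rewrite sube_le0.
- by rewrite e subee.
- by apply: filterS le => z; rewrite sube_le0.
- by move: e; case: (u x) => [r| |] //=; rewrite -EFinB => -[/eqP]; rewrite subr_eq0 => /eqP ->.
Qed.

Lemma usc_on_eq K u v : (forall x, K x -> u x = v x) -> usc_on K u -> usc_on K v.
Proof.
move=> uv uK x Kx; have [ux Hx] := uK x Kx; rewrite -uv //; split=> // a /Hx.
by rewrite !near_withinE; apply: filterS => z Hz Kz; rewrite -uv // Hz.
Qed.

Lemma subharmonic_eq (F : set (jet2 X)) (Y : set X) u v : open Y ->
  (forall x, Y x -> u x = v x) -> subharmonic F Y u -> subharmonic F Y v.
Proof.
move=> oY uv /subharmonicP[uY H]; apply/subharmonicP; split; first exact: usc_on_eq uv uY.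
move=> x phi Yx Hp le e; apply: H => //; last by rewrite uv.
by apply: filterS2 (open_nbhs_nbhs (conj oY Yx)) le => z /uv ->.
Qed.

Lemma sqnorm_le (w : 'rV[R]_n) : (`|w| ^+ 2 <= \sum_j w 0 j ^+ 2)%R.
Proof.
have [->|w0] := eqVneq w 0%R.
  by rewrite normr0 expr0n sumr_ge0 // => j _; exact: sqr_ge0.
have [|[i j] /= E] := @mx_norm_neq0 R 1 n w.
  by apply: contra w0 => /eqP /mx_norm_eq0 ->.
have -> : (`|w| = `|w i j|)%R by exact: E.
rewrite real_normK ?num_real // ord1 (bigD1 j) //= lerDl.
by rewrite sumr_ge0 // => l _; exact: sqr_ge0.
Qed.

(** [B] and [D] are the open and closed coordinate balls of radii [r] and [r / 2] in the sup norm,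
    and [eta] is [(r / 2) ^+ 2]. Since [bump x] dominates the square of the sup norm, it is at least
    [eta] on the collar between [D] and [B], where functions get glued, and a point of [D] where it
    is below [eta] is interior to [D]. *)
Lemma good_neighborhood x (W : set X) : nbhs x W ->
  exists (B D : set X) (eta : R),
    [/\ open B, compact D, D `<=` B, B `<=` W & nbhs x D] /\
    [/\ (0 < eta)%R, forall z, B z -> cdom (chart_at x) z,
        forall z, B z -> ~ D z -> (eta <= bump x z)%R &
        forall z, D z -> (bump x z < eta)%R -> nbhs z D].
Proof.
move=> nW; pose c := chart_at x; pose p := cmap c x.
have dx : cdom c x := chart_at_dom x.
have : nbhs p [set q | crange c q /\ W (cinv c q)].
  by apply: filterI; [exact: near_crange|exact: near_cinv].
case/nbhs_ballP => r /= r0 H.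
have Hn q : (`|q - p| < r)%R -> crange c q /\ W (cinv c q).
  by move=> qp; apply: H; rewrite -ball_normE /= distrC.
pose S (e : R) := [set z | cdom c z /\ (`|cmap c z - p| < e)%R].
have oS e : open (S e).
  rewrite openE => z [dz ze]; apply: filterI; first exact: near_cdom.
  apply: (near_cmap dz (Q := fun q => (`|q - p| < e)%R)).
  have d0 : (0 < e - `|cmap c z - p|)%R by rewrite subr_gt0.
  apply: filterS (near_norm _ d0) => q; rewrite ltrBrDr; apply: le_lt_trans.
  by rewrite -[(q - p)%R](subrKA (cmap c z)) ler_normD.
have r2 : (0 < r / 2)%R by rewrite divr_gt0.
have rr : (r / 2 < r)%R by rewrite ltr_pdivrMr // mulrDr mulr1 ltrDl.
pose D := [set z | cdom c z /\ (`|cmap c z - p| <= r / 2)%R].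
pose C := [set q : 'rV[R]_n | (`|q - p| <= r / 2)%R].
have cC : compact C.
  apply: bounded_closed_compact.
    exists (`|p| + r / 2)%R; split; first exact: num_real.
    move=> M HM q /= qC; rewrite (le_trans _ (ltW HM)) //.
    by rewrite -[q in X in (X <= _)%R](subrK p) addrC (le_trans (ler_normD _ _)) // lerD2l.
  rewrite (_ : C = closed_ball_ (@Num.norm R 'rV[R]_n) p (r / 2)%R).
    exact: closed_closed_ball_.
  by apply/seteqP; split=> q; rewrite /C /closed_ball_ /= distrC.
(* Compactness of the ball in coordinates passes to [D], as [cinv c] is continuous on it. *)
have DE : D = cinv c @` C.
  apply/seteqP; split=> [z [dz zp]|_ [q qC <-]].
    by exists (cmap c z) => //; rewrite cmapK.
  have [|/crangeP[dq Eq] _] := Hn q; first exact: le_lt_trans qC rr.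
  by split=> //; rewrite Eq.
have nD z : S (r / 2)%R z -> nbhs z D.
  move=> Sz; apply: filterS (open_nbhs_nbhs (conj (oS (r / 2)%R) Sz)) => t [dt tp].
  by split=> //; exact: ltW.
have Sx : S (r / 2)%R x by split=> //; rewrite subrr normr0.
have bE z : (`|cmap c z - p| ^+ 2 <= bump x z)%R.
  apply: le_trans (sqnorm_le _) _; rewrite /bump /= sqdistE.
  by apply: ler_sum => j _; rewrite !mxE.
exists (S r), D, ((r / 2) ^+ 2)%R; split; split.
- exact: oS.
- rewrite DE; apply: continuous_compact => //.
  apply: continuous_in_subspaceT => q; rewrite inE => qC.
  apply: cinv_continuous; apply: (Hn q _).1; exact: le_lt_trans qC rr.
- by move=> z [dz zp]; split=> //; exact: le_lt_trans zp rr.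
- by move=> z [dz zp]; have [_] := Hn _ zp; rewrite cmapK.
- exact: nD.
- by rewrite exprn_gt0.
- by move=> z [].
- move=> z [dz zp] nDz; apply: le_trans (bE z).
  rewrite ler_sqr ?nnegrE ?(ltW r2) // leNgt; apply/negP => h; apply: nDz.
  by split=> //; exact: ltW.
- move=> z [dz zp] bz; apply: nD => //; split=> //.
  rewrite ltNge; apply/negP => h; move: bz; rewrite ltNge => /negP; apply.
  by apply: le_trans (bE z); rewrite ler_sqr ?nnegrE ?(ltW r2).
Qed.

End Manifold.
End Semicontinuity.

(** * Subharmonic functions *)

Section Viscosity.
Variables (R : realType) (n : nat) (X : manifold R n).
Implicit Types (x y z : X) (u w : X -> \bar R) (K Y B D : set X) (f g beta : X -> R).
Implicit Types (F : set (jet2 X)).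
Local Open Scope ereal_scope.

(** Conditions (P) and (N) are isolated so that the lemmas below can be applied to [F] and to its
    dual alike. *)
Definition positivity F := forall x (v v' : jetfib R n), fibre F x v -> Pjets x v' -> fibre F x (v + v')%R.

Definition negativity F := forall x (v : jetfib R n) (r : R), (r <= 0)%R -> fibre F x v ->
  fibre F x (v + (r, 0, 0))%R.

Lemma jval_jet_at x f : jval (jet_at x f) = f x.
Proof. by rewrite /jval /= (cmapK (chart_at_dom x)). Qed.

Lemma max_jet x f : C2_near x f -> (\forall z \near x, (f z <= f x)%R) ->
  (forall i, jdiff (jet_at x f) 0%R i = 0%R) /\
  (forall v : 'rV[R]_n, ((v *m jhess (jet_at x f) *m v^T) 0 0 <= 0)%R).
Proof.
move=> /C2_near_chart[U [oU Ux Hf]] fmax; pose c := chart_at x.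
have fm : \forall q \near cmap c x, ((f \o cinv c) q <= (f \o cinv c) (cmap c x))%R.
  rewrite /= (cmapK (chart_at_dom x)).
  exact: (near_cinv (chart_at_dom x) fmax).
split=> [i|v].
  apply: etrans (jdiff_coord (f \o cinv c) (cmap c x) i) _.
  exact: (max_partial i oU (CkS Hf) Ux fm).
exact: (max_hessian v oU Hf Ux fm).
Qed.

(** The difference [f - g] has a local maximum at [x]: its differential vanishes and its Hessian is
    nonpositive. Through (P), membership in [F] passes from the jet of [f] to that of [g]. *)
Lemma touching_jet x f g : C2_near x f -> C2_near x g ->
  (\forall z \near x, (f z <= g z)%R) -> f x = g x ->
  Pjets x (jet_at x g - jet_at x f)%R.
Proof.
move=> Hf Hg fg fgx; pose h : X -> R := (f \+ (fun z => -1 * g z))%R.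
have Hg' := C2_near_scale (-1)%R Hg.
have hx : h x = 0%R by rewrite /h /= fgx mulN1r subrr.
have hm : \forall z \near x, (h z <= h x)%R.
  by apply: filterS fg => z; rewrite hx /h /= mulN1r subr_le0.
have [h1 h2] := max_jet (C2_near_add Hf Hg') hm.
have E := etrans (jet_at_add Hf Hg') (congr1 (+%R (jet_at x f)) (jet_at_scale (-1)%R Hg)).
have h0 := jval_jet_at x h; rewrite hx in h0.
move: (jet_at x (f \+ (fun z => -1 * g z))%R) E h0 h1 h2.
move: (jet_at x f) (jet_at x g) => a b v E h0 h1 h2.
have -> : (b - a)%R = (-1 *: v)%R by rewrite E scalerDr scalerA mulN1r opprK scale1r scaleN1r addrC.
split=> [||t].
- by rewrite -[LHS]/(-1 * jval v)%R h0 mulr0.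
- by apply/rowP => i; rewrite jdiffZi h1 mulr0 mxE.
- have -> : jhess (-1 *: v)%R = (- jhess v)%R by apply/matrixP => i j; rewrite jhessZi !mxE mulN1r.
  by rewrite mulmxN mulNmx mxE oppr_ge0 h2.
Qed.

Definition glue D u beta : X -> \bar R :=
  fun z => if `[< D z >] then maxe (u z) (beta z)%:E else u z.

Lemma glue_in D u beta z : D z -> glue D u beta z = maxe (u z) (beta z)%:E.
Proof. by move=> Dz; rewrite /glue asboolT. Qed.

Lemma glue_out D u beta z : ~ D z -> glue D u beta z = u z.
Proof. by move=> Dz; rewrite /glue asboolF. Qed.

Lemma glue_ge D u beta z : u z <= glue D u beta z.
Proof. by rewrite /glue; case: ifP => // _; rewrite le_max lexx. Qed.

(** On the open set [B] the glued function is the maximum of [u] and [beta], because [beta <= u] on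
    the collar; off the closed set [D] it is [u]. Where it differs from [u], a test function touches
    the smooth function [beta] from above, and [touching_jet] applies. *)
Lemma glue_subharmonic F K Y u beta B D : positivity F -> open Y -> Y `<=` K ->
  usc_on K u -> subharmonic F Y u -> open B -> closed D -> D `<=` B ->
  (forall x, K x -> B x -> {for x, continuous (beta : X -> R^o)}) ->
  (forall x, Y x -> B x -> C2_near x beta /\ F (Jet x (jet_at x beta))) ->
  (forall x, K x -> B x -> ~ D x -> (beta x)%:E <= u x) ->
  usc_on K (glue D u beta) /\ subharmonic F Y (glue D u beta).
Proof.
move=> FP oY YK uK /subharmonicP[uY HY] oB cD DB cb bF bu.
have gB z : K z -> B z -> glue D u beta z = maxe (u z) (beta z)%:E.
  move=> Kz Bz; have [Dz|nDz] := pselect (D z); first exact: glue_in.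
  by rewrite glue_out // max_l // bu.
have gK : usc_on K (glue D u beta).
  move=> x Kx; have [ux Hx] := uK x Kx.
  have [Bx|nBx] := pselect (B x); last first.
    have nDx : ~ D x by move=> /DB.
    have nD : \forall z \near x, ~ D z.
      by apply: (open_nbhs_nbhs (conj (closed_openC cD) _)).
    rewrite glue_out //; split=> // a /Hx; rewrite !near_withinE.
    by apply: filterS2 nD => z nDz Hz Kz; rewrite glue_out // Hz.
  rewrite gB //; split=> [|a]; first by rewrite gt_max ux ltry.
  rewrite gt_max lte_fin => /andP[/Hx ua ba]; move: ua; rewrite !near_withinE.
  apply: filterS3 (near_lt_continuous (cb x Kx Bx) ba) (open_nbhs_nbhs (conj oB Bx)).
  by move=> z bz Bz Hz Kz; rewrite gB // gt_max Hz //= lte_fin.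
split=> //; apply/subharmonicP; split; first exact: usc_on_sub gK.
move=> x phi Yx Hp le e; have Kx := YK x Yx.
have [E|nE] := eqVneq (glue D u beta x) (u x).
  apply: HY => //; last by rewrite -E.
  by apply: filterS le => z; apply: le_trans; exact: glue_ge.
have Dx : D x by apply: contrapT => nDx; move: nE; rewrite glue_out // eqxx.
have Bx := DB x Dx; have [Hb Fb] := bF x Yx Bx.
have bx : (beta x)%:E = (phi x)%:E.
  by rewrite -e gB //; move: nE; rewrite gB // /Order.max; case: ifP => //; rewrite eqxx.
have P : Pjets x (jet_at x phi - jet_at x beta)%R.
  apply: touching_jet => //; last by case: bx.
  apply: filterS3 le (open_nbhs_nbhs (conj oB Bx)) (open_nbhs_nbhs (conj oY Yx)).
  move=> z le Bz Yz; rewrite -lee_fin; apply: le_trans le.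
  by rewrite gB ?le_max ?lexx ?orbT //; exact: YK.
have := FP x _ _ Fb P; rewrite /fibre /=.
by move: (jet_at x phi) (jet_at x beta) => a b; rewrite addrC subrK.
Qed.

Lemma perturb_continuous x f (e k : R) : C2_near x f ->
  {for x, continuous (perturb x f e k : X -> R^o)}.
Proof.
by move=> Hf; apply: C2_near_continuous; apply: C2_near_perturb Hf; exact: chart_at_dom.
Qed.

Lemma perturb_center x f (e k : R) : perturb x f e k x = (f x + k)%R.
Proof. by rewrite /perturb /= bump0 mulr0 addr0. Qed.

(** If the jet of a test function [phi] were outside [F], so would be the nearby jets
    of [phi + ep * bump x + k]; maximizing [u - phi - ep * bump x] over a small ball
    for some [u] in the family yields such a test function for [u]. *)
Lemma sup_subharmonic F K Y (S : set (X -> \bar R)) (U : X -> \bar R) :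
  closed F -> open Y -> Y `<=` K ->
  (forall u, S u -> subharmonic F Y u) ->
  (forall x, U x = ereal_sup [set u x | u in S]) ->
  (forall x, K x -> usr K U x < +oo) -> subharmonic F Y (usr K U).
Proof.
move=> cF oY YK HS UE Uoo; apply/subharmonicP.
split; first by apply: usc_on_sub YK _; exact: usr_usc.
move=> x phi Yx Hphi le e; apply: contrapT => nF.
have [d d0 Hd] := jet_stable Hphi (closed_openC cF) nF.
have [B [D [eta [[oB cD DB BW nD] [eta0 Bc bB bD]]]]] := good_neighborhood
  (filterI (filterI (open_nbhs_nbhs (conj oY Yx)) le) (filterI Hd (C2_near_near Hphi))).
pose ep : R := (d / 2)%R.
have ep0 : (0 < ep)%R by rewrite divr_gt0.
have epd : (`|ep| < d)%R by rewrite ger0_norm ?ltW // /ep; lra.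
(* The first bound will give [|k| < d], the second will make [bump x y < eta] at the maximum point
   [y], hence [y] interior to [D]. *)
pose de := Num.min ep (ep * eta / 2)%R.
have de0 : (0 < de)%R by rewrite lt_min ep0 /= !divr_gt0 // mulr_gt0.
have [dl1 dl2] : (de <= ep)%R /\ (de <= ep * eta / 2)%R by rewrite !ge_min !lexx orbT.
pose psi := perturb x phi ep 0.
(* If no member of the family comes within [de] of [psi] on [D], then [U <= psi - de] there, and the
   regularization at [x] is at most [phi x - de / 2]: a contradiction. *)
have [[z [u [Dz Su uz]]]|no] :=
    pselect (exists z u, [/\ D z, S u & (psi z - de)%:E < u z]); last first.
  have cpsi : {for x, continuous (psi : X -> R^o)} by exact: perturb_continuous.
  have px : (psi x < phi x + de / 2)%R by rewrite /psi perturb_center addr0 ltrDl divr_gt0.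
  have : usr K U x <= (phi x - de / 2)%:E.
    apply: usr_le; apply: filterS2 nD (near_lt_continuous cpsi px) => z Dz pz Kz.
    rewrite UE; apply: ge_ereal_sup => _ [u Su <-].
    rewrite leNgt; apply/negP => h; apply: no; exists z, u; split=> //.
    by apply: lt_trans h; rewrite lte_fin; lra.
  by rewrite e lee_fin; lra.
have DY y : D y -> Y y by move=> /DB/BW[[]].
have cpsi y : D y -> {for y, continuous (psi : X -> R^o)}.
  move=> /DB By; have [_ [_ Hy]] := BW _ By; apply: C2_near_continuous.
  by apply: C2_near_perturb Hy; exact: Bc.
have uD : usc_on D (fun y => u y - (psi y)%:E).
  apply: usc_on_subr cpsi; apply: usc_on_sub (HS _ Su).1 => y; exact: DY.
have [y Dy ymax] := usc_max cD (ex_intro _ z Dz) uD.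
have uphi : u y <= (phi y)%:E.
  have [[_ le'] _] := BW _ (DB _ Dy); apply: le_trans le'.
  apply: le_trans (usr_ge U (YK _ (DY _ Dy))); rewrite UE.
  by apply: ereal_sup_ubound; exists u.
have psiE t : psi t = (phi t + ep * bump x t)%R by rewrite /psi /perturb /= addr0.
have [r ur] : exists r : R, u y = r%:E.
  have := ymax z Dz; move: uphi; case: (u y) => [r| |] //; first by exists r.
  by move=> _; rewrite leeNy_eq => /eqP; move: uz; case: (u z).
(* The maximum of [u - psi] on [D], so that [psi + k] touches [u] at [y]. It exceeds [- de] by the
   choice of [z], and is at most [- (ep * bump x y)] because [u <= phi] on [D]. *)
pose k := (r - psi y)%R.
have k1 : (- de < k)%R.
  have := ymax z Dz; rewrite ur -EFinB -/k; rewrite -lte_fin; apply: lt_le_trans.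
  by move: uz; case: (u z) => [t| |] //; rewrite -?EFinB ?lte_fin ?ltry //; lra.
have k2 : (k <= - (ep * bump x y))%R.
  by move: uphi; rewrite ur lee_fin /k psiE; lra.
have by0 := bump_ge0 x y.
have kd : (`|k| < d)%R.
  have h : (0 <= ep * bump x y)%R by rewrite mulr_ge0 // ltW.
  by rewrite ler0_norm; [rewrite /ep in dl1; lra|lra].
have nDy : nbhs y D.
  apply: bD => //; rewrite -(ltr_pM2l ep0).
  have h : (0 < ep * eta)%R by rewrite mulr_gt0.
  by lra.
have [[_ _] [Hst Hy]] := BW _ (DB _ Dy).
have [Hk nFk] := Hst ep k epd kd; apply: nFk.
have /subharmonicP[_ Hu] := HS _ Su.
have pE t : perturb x phi ep k t = (psi t + k)%R by rewrite psiE.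
apply: Hu => //; first exact: DY.
- apply: filterS nDy => t Dt; have := ymax t Dt; rewrite ur -EFinB -/k pE.
  by case: (u t) => [q| |] //; rewrite -?EFinB ?lee_fin ?leNye //; lra.
- by rewrite pE ur /k addrC subrK.
Qed.

(** Otherwise the negative of a test function, lowered by [ep * bump x] and raised by
    [k], can be glued into [U] near [x], and exceeds [U] close to [x]. *)
Lemma lower_subharmonic F K Y (U : X -> \bar R) : positivity F -> open Y -> Y `<=` K ->
  usc_on K U -> subharmonic F Y U ->
  (forall w, usc_on K w -> subharmonic F Y w -> (forall x, K x -> ~ Y x -> w x = U x) ->
     forall x, K x -> w x <= U x) ->
  (forall x, K x -> usr K (fun z => - U z) x < +oo) ->
  subharmonic (dual F) Y (usr K (fun z => - U z)).
Proof.
move=> FP oY YK uK FU Umax Voo; set V := usr K _.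
apply/subharmonicP; split; first by apply: usc_on_sub YK _; exact: usr_usc.
move=> x f Yx Hf le e; rewrite /dual /= => nF.
pose g : X -> R := (fun z => -1 * f z)%R.
have Hg : C2_near x g by exact: C2_near_scale.
(* A jet lies outside the dual exactly when its negative is in the interior of [F]. *)
have gW : F° (Jet x (jet_at x g)).
  have E : jet_at x g = (- jet_at x f)%R by rewrite -scaleN1r; exact: jet_at_scale.
  by rewrite E.
have [d d0 Hd] := jet_stable Hg (open_interior F) gW.
have [B [D [eta [[oB cD DB BW nD] [eta0 Bc bB bD]]]]] := good_neighborhood
  (filterI (filterI (open_nbhs_nbhs (conj oY Yx)) le) (filterI Hd (C2_near_near Hg))).
pose ep : R := (d / 2)%R.
have ep0 : (0 < ep)%R by rewrite divr_gt0.
have epd : (ep < d)%R by rewrite /ep; lra.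
(* On the collar [bump x >= eta], so [k <= ep * eta] gives [beta <= - f <= U] there; [k <= ep] keeps
   the perturbation within the range of stability. *)
pose k := Num.min ep (ep * eta)%R.
have k0 : (0 < k)%R by rewrite lt_min ep0 /= mulr_gt0.
have [kl1 kl2] : (k <= ep)%R /\ (k <= ep * eta)%R by rewrite !ge_min !lexx orbT.
pose beta := perturb x g (- ep) k.
have epd' : (`|- ep| < d)%R by rewrite normrN ger0_norm // ltW.
have kd' : (`|k| < d)%R by rewrite ger0_norm ?(ltW k0) // (le_lt_trans kl1).
have betaE t : beta t = (- f t - ep * bump x t + k)%R.
  by rewrite /beta /perturb /g /= mulN1r mulNr.
have cDc : closed D by exact: compact_closed (@points_hausdorff R n X) cD.
have Bb z : B z -> C2_near z beta /\ F (Jet z (jet_at z beta)).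
  move=> /BW[_ [Hst _]]; have [h1 h2] := Hst _ _ epd' kd'.
  by split; [exact: h1|exact: interior_subset h2].
have [gK gF] : usc_on K (glue D U beta) /\ subharmonic F Y (glue D U beta).
  apply: (glue_subharmonic FP oY YK uK FU oB cDc DB).
  - by move=> z _ Bz; apply: C2_near_continuous; exact: (Bb z Bz).1.
  - by move=> z _ Bz; exact: Bb.
  - move=> z Kz Bz nDz; have [[_ Vf] _] := BW _ Bz.
    have Uf : - U z <= (f z)%:E by apply: le_trans Vf; exact: (usr_ge (fun t => - U t)).
    have bz := bB z Bz nDz.
    apply: (@le_trans _ _ (- f z)%:E).
      rewrite lee_fin betaE.
      have := ler_wpM2l (ltW ep0) bz; lra.
    by rewrite EFinN leeNl.
(* The glued function agrees with [U] off [Y], so maximality of [U] applies to it. *)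
have UD z : D z -> (beta z)%:E <= U z.
  move=> Dz; have [[Yz _] _] := BW _ (DB _ Dz).
  have h := Umax _ gK gF _ z (YK _ Yz).
  apply: le_trans (h _); first by rewrite glue_in // le_max lexx orbT.
  move=> t Kt nYt; rewrite glue_out // => Dt; apply: nYt.
  by have [[]] := BW _ (DB _ Dt).
have cb : {for x, continuous (beta : X -> R^o)} by exact: perturb_continuous.
have bx : (- f x + k / 2 < beta x)%R by rewrite /beta perturb_center /g mulN1r; lra.
(* Near [x] this follows from [U >= beta > - f x + k / 2]; it contradicts [V x = f x]. *)
have : V x <= (f x - k / 2)%:E.
  apply: usr_le; apply: filterS2 nD (near_gt_continuous cb bx) => z Dz bz Kz.
  rewrite leeNl -EFinN; apply: le_trans (UD z Dz); rewrite lee_fin; lra.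
by rewrite e lee_fin; lra.
Qed.

End Viscosity.

(** * The Dirichlet problem *)

Section Dirichlet.
Variables (R : realType) (n : nat) (X : manifold R n).
Implicit Types (x y z : X) (u w : X -> \bar R) (K Y B D Omega : set X) (f g rho phi : X -> R).
Implicit Types (F : set (jet2 X)).

Lemma subeq_positivity F : subequation F -> positivity F.
Proof. by move=> hF x v v'; exact: subeq_P. Qed.

Lemma subeq_negativity F : subequation F -> negativity F.
Proof.
move=> hF x v r r0 Fv; apply: (subeq_N hF Fv); exists r => //.
exact: jet_at_cst.
Qed.

Lemma subeq_closed F : subequation F -> closed F.
Proof. by move=> hF; rewrite (subeq_T hF); exact: closed_closure. Qed.

Lemma interior_translate (A : set (jetfib R n)) (w : jetfib R n) :
  (forall v, A v -> A (v + w)) -> forall v, A° v -> A° (v + w).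
Proof.
move=> Aw v Av; have c := @jet_addr_continuous R n (- w) (v + w).
rewrite /continuous_at addrK in c.
have H : nbhs (v + w) ((fun a : jetfib R n => a - w) @^-1` A) := c _ Av.
by apply: filterS H => a /Aw; rewrite subrK.
Qed.

(** The interior of a fibre is stable under the translations that preserve the fibre, and (T)
    identifies it with the fibre of the interior of [F], in terms of which the dual is defined. *)
Lemma dual_positivity F : subequation F -> positivity (dual F).
Proof.
move=> hF x v w nF Pw F1; apply: nF; move: F1; rewrite /dual /=.
rewrite -[F° _]/(fibre F° x _) -[X in _ -> X]/(fibre F° x _) -(subeq_T_int hF) => F1.
have := interior_translate (fun v Fv => subeq_positivity hF Fv Pw) F1.
by rewrite opprD subrK.
Qed.

Lemma dual_negativity F : subequation F -> negativity (dual F).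
Proof.
move=> hF x v r r0 nF F1; apply: nF; move: F1; rewrite /dual /=.
rewrite -[F° _]/(fibre F° x _) -[X in _ -> X]/(fibre F° x _) -(subeq_T_int hF) => F1.
have := interior_translate (fun v Fv => subeq_negativity hF r0 Fv) F1.
by rewrite opprD subrK.
Qed.

(** A test function of [u - N], raised by [N], is one of [u]; lowering its jet back is allowed by
    (N). *)
Lemma subharmonic_sub_cst F Y u (N : R) : negativity F -> 0 <= N ->
  subharmonic F Y u -> subharmonic F Y (fun x => u x - N%:E)%E.
Proof.
move=> FN N0 /subharmonicP[uY Hu]; apply/subharmonicP; split.
  by apply: usc_on_subr => // x _; exact: cst_continuous.
move=> x phi Yx Hp le e.
have HN := C2_near_add Hp (@C2_near_cst R n X N x).
have FJ : fibre F x (jet_at x (phi \+ cst N)).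
  apply: Hu => //.
  - by apply: filterS le => z; rewrite leeBlDr.
  - by rewrite /= EFinD -e subeK.
have E := etrans (jet_at_add Hp (@C2_near_cst R n X N x)) (congr1 (+%R (jet_at x phi)) (jet_at_cst N x)).
have N0' : - N <= 0 by rewrite oppr_le0.
have := FN x _ _ N0' FJ; rewrite E /fibre /=.
move: (jet_at x phi) => a; rewrite -addrA (_ : _ + (- N, 0, 0) = 0) ?addr0 //.
by apply: jetP; rewrite /jval /jdiff /jhess /= ?subrr ?addr0.
Qed.

Lemma strict_subharmonicW (G : jet_metric X) F K u :
  strict_subharmonic_cpt G F K u -> subharmonic_cpt F K u.
Proof.
case=> uK Hu; split=> //; apply/subharmonicP; split.
  exact: usc_on_sub (@interior_subset _ K) uK.
move=> x phi Kx Hp le e; have [B [c [oB Bx BK c0 /subharmonicP[_ HB]]]] := Hu x Kx.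
by have [] := HB x phi Bx Hp le e.
Qed.

(** * Smooth domains, boundary data and barriers *)

Section Domain.
Variables (Omega : set X).
Hypothesis hO : smooth_domain Omega.
Notation K := (closure Omega).

Let oO : open Omega := dom_open hO.

Lemma boundaryE x : boundary Omega x <-> K x /\ ~ Omega x.
Proof. by rewrite /boundary ((interior_id Omega).1 oO). Qed.

Lemma domain_dec x : K x -> Omega x \/ boundary Omega x.
Proof.
by move=> Kx; have [?|nO] := pselect (Omega x); [left|right; apply/boundaryE].
Qed.

Lemma defining_le0 x rho B : B x -> K x ->
  (forall z, B z -> boundary Omega z <-> rho z = 0) ->
  (forall z, B z -> Omega z -> rho z < 0) -> rho x <= 0.
Proof.
move=> Bx Kx h0 h1; case: (domain_dec Kx) => [/(h1 _ Bx)/ltW //|].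
by move=> /(h0 _ Bx) ->.
Qed.

(** A smooth boundary has no slits: at a boundary point interior to the closure, a defining function
    would have a local maximum with nonzero differential. Comparison on the closure thus concerns
    functions subharmonic on [Omega] itself. *)
Lemma interior_closure_domain : K° = Omega.
Proof.
apply/seteqP; split; last first.
  by move=> x Ox; apply: filterS (open_nbhs_nbhs (conj oO Ox)); exact: subset_closure.
move=> x Kx; apply: contrapT => nO.
have bx : boundary Omega x by apply/boundaryE; split=> //; exact: nbhs_singleton Kx.
have [rho [B [oB Bx Hk h0 [hd h1]]]] := dom_smooth_boundary hO bx.
have rx : rho x = 0 by apply/(h0 x Bx).
have Hr : C2_near x rho := C2_nearI oB Bx (Hk 2%N).
have [| g0 _] := max_jet Hr.
  apply: filterS2 Kx (open_nbhs_nbhs (conj oB Bx)) => z Kz Bz.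
  by rewrite rx; exact: defining_le0 Bz Kz h0 h1.
have /negP := hd x Bx bx; apply; apply/eqP/rowP => i; rewrite g0 mxE //.
Qed.

Lemma boundary_closure x : boundary K x <-> boundary Omega x.
Proof.
rewrite boundaryE /boundary interior_closure_domain -(closure_id K).1 //.
exact: closed_closure.
Qed.

Lemma compact_boundary : compact (boundary Omega).
Proof.
apply: subclosed_compact (dom_relatively_compact hO) _; last by move=> x /boundaryE[].
rewrite (_ : boundary Omega = K `&` ~` Omega).
  by apply: closedI; [exact: closed_closure|exact: open_closedC].
by apply/seteqP; split=> x /boundaryE.
Qed.

Variables (phi : X -> R).
Hypothesis cphi : {within boundary Omega, continuous phi}.

Lemma near_boundary x (P : set R) : boundary Omega x -> nbhs (phi x) P ->
  \forall z \near x, boundary Omega z -> P (phi z).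
Proof.
move=> bx HP; have /subspace_continuousP c := cphi.
exact (c x bx P HP).
Qed.

Lemma boundary_value_gt x (a : R) : boundary Omega x -> a < phi x ->
  \forall z \near x, boundary Omega z -> a < phi z.
Proof. move=> bx ap; apply: (@near_boundary x (fun v => a < v)) => //.
exact: open_nbhs_nbhs (conj (@open_gt R a) ap). Qed.

Lemma below_boundary_values (psi : X -> \bar R) : usc_on K psi ->
  exists2 N : R, 0 <= N & forall x, boundary Omega x -> (psi x - N%:E <= (phi x)%:E)%E.
Proof.
(* The boundary is empty when [Omega] is a compact component of [X]. *)
move=> uK; have [[x0 bx0]|no] := pselect (boundary Omega !=set0); last first.
  by exists 0 => // x bx; exfalso; apply: no; exists x.
(* [usc_on_subr] does not apply, since [phi] is continuous only along the boundary. *)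
have h : usc_on (boundary Omega) (fun x => psi x - (phi x)%:E)%E.
  move=> x bx; have Kx : K x by have /boundaryE[] := bx.
  have [ux Hx] := uK x Kx; split.
    by move: ux; case: (psi x) => [r| |] // _; rewrite -?EFinB ltry.
  move=> a; rewrite lteBlDr // -EFinD => /ereal_between[b [ub]].
  rewrite lte_fin => bf; have bf' : b - a < phi x by rewrite ltrBlDr addrC.
  have := Hx b ub; rewrite !near_withinE.
  apply: filterS2 (boundary_value_gt bx bf') => z bz Hz bz'.
  have Kz : K z by have /boundaryE[] := bz'.
  rewrite lteBlDr // -EFinD (lt_trans (Hz Kz)) // lte_fin.
  by rewrite -ltrBlDl bz.
have [y by' ymax] := usc_max compact_boundary (ex_intro _ x0 bx0) h.
have [N [N0 HN]] : exists N : R, 0 <= N /\ (psi y - (phi y)%:E <= N%:E)%E.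
  have [+ _] := h y by'; case: (_ - _)%E => [r| |] // _.
    by exists (Num.max 0 r); rewrite lee_fin !le_max !lexx orbT.
  by exists 0; rewrite lexx leNye.
exists N => // x bx; rewrite leeBlDr // addeC -leeBlDr //.
exact: le_trans (ymax x bx) HN.
Qed.

Lemma jet_cstD (a b : R) : (a, 0, 0) + (b, 0, 0) = (a + b, 0, 0) :> jetfib R n.
Proof. by apply: jetP; rewrite /jval /jdiff /jhess /= ?addr0. Qed.

Lemma jet_cstZ (a b : R) : a *: ((b, 0, 0) : jetfib R n) = (a * b, 0, 0).
Proof. by apply: jetP; rewrite /jval /jdiff /jhess /= ?scaler0. Qed.

(** The barrier at [x0] is [lambda + t (rho - e |z - x0|^2)] for large [t]: the
    asymptotic interior makes it subharmonic, the quadratic term pushes it below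
    [psi] away from [x0]. *)
Lemma barrier F (psi : X -> \bar R) (m : R) x0 (eps : R) :
  positivity F -> negativity F -> strictly_convex_boundary F Omega ->
  perron_family F Omega phi psi -> (forall x, K x -> m%:E <= psi x)%E ->
  boundary Omega x0 -> 0 < eps ->
  exists2 w, perron_family F Omega phi w &
    \forall z \near x0, K z -> ((phi x0 - eps)%:E < w z)%E.
Proof.
move=> FP FN FC [upsi spsi bpsi] psim bx0 eps0.
(* Strictly between [phi x0 - eps] and [phi x0]: near [x0] the barrier stays above the former and,
   being at most [lambda], below [phi] on the boundary. *)
pose lambda := phi x0 - eps / 2.
have lphi : lambda < phi x0 by rewrite /lambda; lra.
have [rho [[Br [oBr Brx Hk h0 [hd h1]]]]] := FC x0 lambda bx0.
case=> [Jred [V [t0 [Vred nV t00 HV]]]].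
have rx : rho x0 = 0 by apply/(h0 x0 Brx).
have Hr : C2_near x0 rho := C2_nearI oBr Brx (Hk 2%N).
(* [V] is a neighborhood only among reduced jets; [W] is an open set of full jets whose reduced
   members lie in [V]. *)
pose W := [set J : jet2 X | jet_red J -> V J]°.
have WJ : W (Jet x0 (jet_at x0 rho)) by exact: nV.
have [d d0 Hd] := jet_stable Hr (open_interior _) WJ.
pose e := d / 2; have e0 : 0 < e by rewrite divr_gt0.
have ed : `|- e| < d by rewrite normrN ger0_norm ?ltW // /e; lra.
pose h : X -> R := rho \+ (fun z => - e * bump x0 z).
have hx0 : h x0 = 0 by rewrite /h /= bump0 mulr0 addr0.
have C2h z : cdom (chart_at x0) z -> C2_near z rho -> C2_near z h.
  by move=> dz Hz; apply: C2_near_add; [exact: Hz|apply: C2_near_scale; exact: C2_near_bump].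
have ch : {for x0, continuous (h : X -> R^o)}.
  exact: C2_near_continuous (C2h _ (chart_at_dom x0) Hr).
have hd1 : \forall z \near x0, - d < h z < d.
  have [a1 a2] : - d < h x0 /\ h x0 < d by rewrite hx0 oppr_lt0.
  by apply: filterS2 (near_gt_continuous ch a1) (near_lt_continuous ch a2) => z -> ->.
have [B [D [eta [[oB cD DB BW nD] [eta0 Bc bB bD]]]]] := good_neighborhood
  (filterI (filterI (open_nbhs_nbhs (conj oBr Brx)) hd1)
     (filterI Hd (filterI (C2_near_near Hr) (boundary_value_gt bx0 lphi)))).
have cDc : closed D by exact: compact_closed (@points_hausdorff R n X) cD.
(* [t0] serves the asymptotic interior; the quotient brings [beta] below [m], hence below [psi], on
   the collar where [bump x0 >= eta]. *)
pose t := Num.max t0 ((lambda - m) / (e * eta)).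
have t0t : t0 <= t by rewrite le_max lexx.
have tpos : 0 < t by exact: lt_le_trans t00 t0t.
have ee : 0 < e * eta by rewrite mulr_gt0.
have tm : lambda - t * (e * eta) <= m.
  by rewrite lerBlDl -lerBlDr -ler_pdivrMr // le_max lexx orbT.
pose beta : X -> R := cst lambda \+ (fun z => t * h z).
have hle z : B z -> K z -> h z <= - e * bump x0 z.
  move=> /BW[[Brz _] _] Kz; rewrite /h /= gerDr.
  exact: defining_le0 Brz Kz h0 h1.
have hle0 z : B z -> K z -> h z <= 0.
  move=> Bz Kz; apply: le_trans (hle z Bz Kz) _.
  by rewrite mulNr oppr_le0 mulr_ge0 ?bump_ge0 // ltW.
have betaC z : B z -> C2_near z beta.
  move=> Bz; have [_ [_ [Hz _]]] := BW _ Bz.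
  apply: C2_near_add; first exact: C2_near_cst.
  exact: C2_near_scale (C2h _ (Bc _ Bz) Hz).
have betaF z : Omega z -> B z -> F (Jet z (jet_at z beta)).
  move=> Oz Bz; have Kz : K z by exact: subset_closure.
  have [[_ hdz] [Hst [Hz _]]] := BW _ Bz.
  have kd : `|- h z| < d by rewrite normrN ltr_norml.
  (* Subtracting the value of [h] at [z] makes the jet there reduced, as membership in [V]
     requires. *)
  have [_ WP] := Hst (- e) (- h z) ed kd.
  have C2hz := C2h z (Bc _ Bz) Hz.
  have E1 : jet_at z (perturb x0 rho (- e) (- h z)) = jet_at z h + (- h z, 0, 0).
    by apply: etrans (jet_at_add C2hz (@C2_near_cst R n X (- h z) z)) _; rewrite jet_at_cst.
  have VP : V (Jet z (jet_at z (perturb x0 rho (- e) (- h z)))).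
    apply: (interior_subset WP); rewrite /jet_red /=.
    by rewrite jval_jet_at /perturb /= subrr.
  have [_] := HV t _ t0t VP; rewrite /= E1 jet_at_cst => FJ.
  (* The jet of [lambda + t (h - h z)] at [z] is in [F]; the barrier has the smaller value
     [lambda + t * h z], and (N) covers the difference. *)
  have th : t * h z <= 0 by rewrite pmulr_rle0 // hle0.
  have := FN z _ _ th FJ.
  have E2 : jet_at z beta = (lambda, 0, 0) + t *: jet_at z h.
    apply: etrans (jet_at_add (@C2_near_cst R n X lambda z) (C2_near_scale t C2hz)) _.
    by apply: congr2; [exact: jet_at_cst|exact: jet_at_scale].
  rewrite E2 /fibre /=; move: (jet_at z h) => a.
  by rewrite scalerDr jet_cstZ -!addrA jet_cstD mulrN addNr (_ : (0, 0, 0) = 0) ?addr0.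
have [gK gF] : usc_on K (glue D psi beta) /\ subharmonic F Omega (glue D psi beta).
  apply: (glue_subharmonic FP oO (@subset_closure _ Omega) upsi spsi oB cDc DB).
  - by move=> z _ /betaC; exact: C2_near_continuous.
  - by move=> z Oz Bz; split; [exact: betaC|exact: betaF].
  - move=> z Kz Bz nDz; apply: le_trans (psim z Kz); rewrite lee_fin.
    apply: le_trans tm; rewrite /beta /= lerD2l -mulrN ler_pM2l //.
    apply: le_trans (hle z Bz Kz) _; rewrite mulNr lerN2 ler_pM2l //.
    exact: bB.
have beta_le z : B z -> K z -> beta z <= lambda.
  by move=> Bz Kz; rewrite /beta /= gerDl pmulr_rle0 // hle0.
exists (glue D psi beta); first split=> //.
  move=> z bz; have [Dz|nDz] := pselect (D z); last by rewrite glue_out // bpsi.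
  have Bz := DB _ Dz; have Kz : K z by have /boundaryE[] := bz.
  have [_ [_ [_ Hb]]] := BW _ Bz.
  rewrite glue_in // ge_max bpsi //= lee_fin (le_trans (beta_le z Bz Kz)) //.
  exact: ltW (Hb bz).
have cb : {for x0, continuous (beta : X -> R^o)}.
  by apply: C2_near_continuous; apply: betaC; apply: DB; exact: nbhs_singleton nD.
have bx : phi x0 - eps < beta x0 by rewrite /beta /= hx0 mulr0 addr0 /lambda; lra.
apply: filterS2 nD (near_gt_continuous cb bx) => z Dz bz _.
by rewrite glue_in // lt_max lte_fin bz orbT.
Qed.

End Domain.

Lemma real_continuous_usc K u : real_continuous_on K u ->
  usc_on K u /\ usc_on K (fun x => - u x)%E.
Proof.
move=> [uf cu]; have H x (e : R) : K x -> 0 < e -> \forall z \near x, K z ->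
    `|fine (u x) - fine (u z)| < e.
  move=> Kx e0; have /subspace_continuousP c := cu.
  have /cvgrPdist_lt := c x Kx; move=> /(_ e e0); exact.
split=> x Kx; have := uf x Kx; case ux : (u x) => [r| |] // _.
  split=> [|a]; first exact: ltry.
  rewrite lte_fin => ra; rewrite near_withinE; have ar : 0 < a - r by rewrite subr_gt0.
  apply: filterS (H x _ Kx ar) => z + Kz => /(_ Kz).
  have := uf z Kz; case: (u z) => [t| |] // _; rewrite ux /= lte_fin ltr_norml => /andP[h _].
  lra.
split=> [|a]; first exact: ltry.
rewrite lte_fin => ra; rewrite near_withinE; have ar : 0 < a + r by lra.
apply: filterS (H x _ Kx ar) => z + Kz => /(_ Kz).
have := uf z Kz; case: (u z) => [t| |] // _; rewrite ux /= lte_fin ltr_norml => /andP[_ h].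
lra.
Qed.

Lemma usc_real_continuous K u : (forall x, K x -> u x \is a fin_num) ->
  usc_on K u -> usc_on K (fun x => - u x)%E -> real_continuous_on K u.
Proof.
move=> uf u1 u2; split=> //; apply/subspace_continuousP => x Kx.
apply/cvgrPdist_lt => e e0.
have ux := uf x Kx; have [_ h1] := u1 x Kx; have [_ h2] := u2 x Kx.
have : \forall z \near within K (nbhs x), (u z < (fine (u x) + e)%:E)%E.
  by apply: h1; move: ux; case: (u x) => [r| |] //= _; rewrite lte_fin ltrDl.
have : \forall z \near within K (nbhs x), (- u z < (- fine (u x) + e)%:E)%E.
  by apply: h2; move: ux; case: (u x) => [r| |] //= _; rewrite lte_fin ltrDl.
rewrite !near_withinE; apply: filterS2 => z + + Kz => /(_ Kz) + /(_ Kz).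
rewrite -[from_subspace K _ x]/(fine (u x)) -[from_subspace K _ z]/(fine (u z)).
have := uf z Kz; case: (u z) => [t| |] // _ /=; rewrite !lte_fin ltr_norml => a b.
by apply/andP; split; lra.
Qed.

(** Subtracting a large constant brings [u] below [phi] on the boundary and keeps it bounded below;
    the result is the function into which barriers are glued. *)
Lemma family_bounded_below F Omega phi u : smooth_domain Omega -> negativity F ->
  {within boundary Omega, continuous phi} ->
  subharmonic_cpt F (closure Omega) u -> bounded_below_on (closure Omega) u ->
  exists psi (m : R), perron_family F Omega phi psi /\
    forall x, closure Omega x -> (m%:E <= psi x)%E.
Proof.
move=> hO FN cphi [uK uF] [m um]; rewrite (interior_closure_domain hO) in uF.
have [N N0 HN] := below_boundary_values hO cphi uK.
exists (fun x => u x - N%:E)%E, (m - N); split.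
  split=> //; last exact: subharmonic_sub_cst.
  by apply: usc_on_subr => // x _; exact: cst_continuous.
by move=> x Kx; rewrite EFinB leeB // um.
Qed.

(** A barrier [w] at [x0] forces [f <= - w < e - phi x0] near [x0]. This serves for [f = - U] with
    the family of [F], and for [f = U] with the family of the dual and the data [- phi]. *)
Lemma boundary_limit F Omega phi (psi : X -> \bar R) (m : R) (f : X -> \bar R) x0 :
  smooth_domain Omega -> positivity F -> negativity F ->
  strictly_convex_boundary F Omega -> {within boundary Omega, continuous phi} ->
  perron_family F Omega phi psi -> (forall x, closure Omega x -> m%:E <= psi x)%E ->
  (forall w x, perron_family F Omega phi w -> closure Omega x -> w x + f x <= 0)%E ->
  boundary Omega x0 -> (usr (closure Omega) f x0 <= (- phi x0)%:E)%E.
Proof.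
move=> hO FP FN FC cphi psiF psim Hf bx0; apply/lee_addgt0Pr => e e0.
have [w wF Hw] := barrier hO cphi FP FN FC psiF psim bx0 e0.
rewrite -EFinD; apply: usr_le; apply: filterS Hw => z Hz Kz.
have := Hf w z wF Kz; have := Hz Kz.
case: (w z) (f z) => [r| |] [s| |] //=; rewrite ?lee_fin ?lte_fin ?leNye //.
lra.
Qed.

End Dirichlet.

Theorem theorem13p3 (R : realType) (n : nat) (X : manifold R n)
    (g : riemannian_metric X) (G : jet_metric X)
    (F : set (jet2 X)) (Omega : set X) :
  subequation F -> comparison F ->
  smooth_domain Omega ->
  (exists u, strict_subharmonic_cpt G F (closure Omega) u /\
             bounded_below_on (closure Omega) u) ->
  (exists v, strict_subharmonic_cpt G (dual F) (closure Omega) v /\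
             bounded_below_on (closure Omega) v) ->
  strictly_convex_boundary F Omega ->
  strictly_convex_boundary (dual F) Omega ->
  forall phi : X -> R, {within boundary Omega, continuous phi} ->
    dirichlet_solution F Omega phi (perron F Omega phi) /\
    (forall h : X -> \bar R, dirichlet_solution F Omega phi h ->
       forall x, closure Omega x -> h x = perron F Omega phi x).
Proof.
move=> hF cmp hO [u0 [su0 bu0]] [v0 [sv0 bv0]] cF cdF phi cphi.
set K := closure Omega; set U := perron F Omega phi.
have oO := dom_open hO; have OK : Omega `<=` K by exact: subset_closure.
have FP := subeq_positivity hF; have FN := subeq_negativity hF.
have dP := dual_positivity hF; have dN := dual_negativity hF.
pose nphi x := - phi x.
have cnphi : {within boundary Omega, continuous nphi}.
  by move=> x; apply: continuousN; exact: cphi.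
have [psi [m [psiF psim]]] := family_bounded_below hO FN cphi (strict_subharmonicW su0) bu0.
have [psi' [m' [psiF' psim']]] := family_bounded_below hO dN cnphi (strict_subharmonicW sv0) bv0.
have compare u v : perron_family F Omega phi u -> perron_family (dual F) Omega nphi v ->
    forall x, K x -> (u x + v x <= 0)%E.
  move=> [uK uF ub] [vK vF vb]; apply: (cmp K u v (dom_relatively_compact hO)).
  - by split=> //; rewrite (interior_closure_domain hO).
  - by split=> //; rewrite (interior_closure_domain hO).
  - move=> x /(boundary_closure hO) bx; have := leeD (ub x bx) (vb x bx).
    by rewrite -EFinD subrr.
have Uge u x : perron_family F Omega phi u -> (u x <= U x)%E.
  by move=> uF; apply: ereal_sup_ubound; exists u.
have Ule x v : perron_family (dual F) Omega nphi v -> K x -> (U x <= - v x)%E.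
  move=> vF Kx; apply: ge_ereal_sup => _ [u uF <-].
  have := compare u v uF vF x Kx.
  have : (v x < +oo)%E by case: vF => vK _ _; have [] := vK x Kx.
  by case: (u x) (v x) => [r| |] [s| |] //; rewrite ?leNye ?leey // -EFinD !lee_fin; lra.
have Um x : K x -> (m%:E <= U x)%E.
  by move=> Kx; apply: le_trans (psim x Kx) (Uge _ _ psiF).
have Um' x : K x -> (U x <= (- m')%:E)%E.
  by move=> Kx; apply: le_trans (Ule x psi' psiF' Kx) _; rewrite EFinN leeN2 psim'.
have Ufin x : K x -> U x \is a fin_num.
  move=> Kx; rewrite fin_numE; apply/andP; split; apply/eqP => E.
    by have := Um x Kx; rewrite E.
  by have := Um' x Kx; rewrite E.
pose Us := usr K U.
have Usoo x : K x -> (Us x < +oo)%E.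
  move=> Kx; apply: le_lt_trans (ltry (- m')); apply: usr_le.
  by apply: filterS filterT => z _; exact: Um'.
have UsF : perron_family F Omega phi Us.
  split; first exact: usr_usc.
    apply: (@sup_subharmonic R n X F K Omega (perron_family F Omega phi) U) => //.
      exact: subeq_closed.
    by move=> u [].
  (* The regularization could jump above [phi] at the boundary; dual barriers for the data [- phi]
     prevent this, since comparison puts [U] below the negative of each of them. *)
  move=> x bx; rewrite -[phi x]opprK.
  apply: (boundary_limit hO dP dN cdF cnphi psiF' psim') => // w z wF Kz.
  have := Ule z w wF Kz; have := Ufin z Kz.
  by case: (w z) (U z) => [r| |] [s| |] //= _; rewrite -?EFinD ?lee_fin ?addNye //; lra.
have UUs x : K x -> U x = Us x.
  by move=> Kx; apply/eqP; rewrite eq_le (usr_ge U Kx) Uge.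
have [UsK UsO Usb] := UsF.
have UK : usc_on K U by apply: usc_on_eq UsK => x /UUs.
have UO : subharmonic F Omega U by apply: subharmonic_eq UsO => // x /OK /UUs.
have Ub x : boundary Omega x -> (U x <= (phi x)%:E)%E.
  by move=> bx; rewrite UUs ?Usb //; have /(boundaryE hO)[] := bx.
pose V := usr K (fun x => - U x)%E.
have Voo x : K x -> (V x < +oo)%E.
  move=> Kx; apply: le_lt_trans (ltry (- m)); apply: usr_le.
  by apply: filterS filterT => z _ Kz; rewrite EFinN leeN2 Um.
have VF : perron_family (dual F) Omega nphi V.
  split; first exact: usr_usc.
    (* A competitor that agrees with [U] off [Omega] has boundary values at most [phi], so it lies
       in the Perron family. *)
    apply: lower_subharmonic => // w wK wO wU x Kx; apply: Uge; split=> // z bz.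
    have /(boundaryE hO)[Kz nOz] := bz; rewrite wU //; exact: Ub.
  move=> x bx; apply: (boundary_limit hO FP FN cF cphi psiF psim) => // w z wF Kz.
  have := Uge w z wF; have := Ufin z Kz.
  by case: (w z) (U z) => [r| |] [s| |] //= _; rewrite -?EFinD ?lee_fin ?addNye //; lra.
(* Comparison with the member [V] of the dual family gives [U <= - V], the reverse of the trivial
   [- U <= V]; so [- U] inherits upper semicontinuity from [V]. *)
have UV x : K x -> V x = (- U x)%E.
  move=> Kx; apply/eqP; rewrite eq_le (usr_ge (fun x => - U x)%E Kx) andbT.
  by rewrite leeNr; exact: Ule.
have nUK : usc_on K (fun x => - U x)%E by case: VF => VK _ _; apply: usc_on_eq VK => x /UV.
split; first split.
- exact: usc_real_continuous.
- split=> //; case: VF => _ VO _; apply: subharmonic_eq VO => // x /OK /UV //.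
- move=> x bx; apply/eqP; rewrite eq_le Ub //=.
  have Kx : K x by have /(boundaryE hO)[] := bx.
  by case: VF => _ _ /(_ x bx); rewrite UV // /nphi EFinN leeN2.
(* A solution [h] lies in the Perron family and [- h] in the dual one, which bounds [h] by [U] from
   both sides. *)
move=> h [hc [hsub hdsub] hb] x Kx; have [h1 h2] := real_continuous_usc hc.
apply/eqP; rewrite eq_le; apply/andP; split.
  by apply: Uge; split=> // z bz; rewrite hb.
rewrite -[leRHS]oppeK; apply: (Ule x (fun z => - h z)%E _ Kx); split=> // z bz.
by rewrite hb.
Qed.
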